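(* Let $\mathfrak{L}=\mathfrak{s}\oplus\mathrm{Leib}(\mathfrak{L})$ be a finite-dimensional semi-simple left Leibniz algebra over a field $\mathbb{F}$ of characteristic zero with Levi factor $\mathfrak{s}$. Then $$\mathrm{Der}(\mathfrak{L})\cong\mathfrak{s}\oplus\bigoplus_{i=1}^s\bigoplus_{j=1}^t\mathrm{Hom}_{\mathfrak{s}}(\mathfrak{s}_i,M_j)^{\oplus a_ib_j}\oplus\bigoplus_{k=1}^t\mathrm{End}_{\mathfrak{s}}(M_k)^{\oplus b_k^2}$$ as $\mathbb{F}$-vector spaces, where $\mathfrak{s}=\bigoplus_{i=1}^s\mathfrak{s}_i^{\oplus a_i}$ is the decomposition of $\mathfrak{s}$ into a direct sum of pairwise non-isomorphic simple ideals and $\mathrm{Leib}(\mathfrak{L})=\bigoplus_{j=1}^t M_j^{\oplus b_j}$ is the decomposition of $\mathrm{Leib}(\mathfrak{L})$ into a direct sum of pairwise non-isomorphic non-trivial irreducible left $\mathfrak{s}$-submodules.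
   Context: A left Leibniz algebra is an $\mathbb{F}$-vector space $\mathfrak{L}$ with a bilinear multiplication satisfying $x(yz)=(xy)z+y(xz)$ for all $x,y,z\in\mathfrak{L}$. Ideals are two-sided. The Leibniz kernel is the ideal $\mathrm{Leib}(\mathfrak{L}):=\langle x^2\mid x\in\mathfrak{L}\rangle_{\mathbb{F}}$ (the linear span of all squares). A Leibniz algebra $\mathfrak{L}$ is semi-simple if $\mathrm{Leib}(\mathfrak{L})$ contains every solvable ideal of $\mathfrak{L}$. A Levi factor $\mathfrak{s}$ of a finite-dimensional semi-simple $\mathfrak{L}$ is a semi-simple Lie subalgebra such that $\mathfrak{L}=\mathfrak{s}\oplus\mathrm{Leib}(\mathfrak{L})$ as vector spaces. Here $\mathrm{Leib}(\mathfrak{L})$ is a left $\mathfrak{s}$-module via left multiplication in $\mathfrak{L}$, and $\mathfrak{s}$ and its ideals are left $\mathfrak{s}$-modules via the (left) adjoint action. A left module is trivial if the action is zero. $\mathrm{Der}(\mathfrak{L})$ denotes the space of all $\mathbb{F}$-linear derivations of $\mathfrak{L}$ (linear maps $D$ with $D(xy)=D(x)y+xD(y)$), and $\mathrm{Hom}_{\mathfrak{s}}$, $\mathrm{End}_{\mathfrak{s}}$ denote the spaces of homomorphisms, respectively endomorphisms, of left $\mathfrak{s}$-modules. $V^{\oplus n}$ denotes the direct sum of $n$ copies of $V$, so the $a_i$ and $b_j$ are the multiplicities in the respective decompositions. *)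

(* Defs.v *)
From HB Require Import structures.
From mathcomp Require Import all_boot all_order all_algebra.
From mathcomp Require Import boolp.

Set Implicit Arguments.
Unset Strict Implicit.
Unset Printing Implicit Defensive.

Import GRing.Theory.
Local Open Scope ring_scope.

(* The span of an arbitrary, possibly infinite, set P of vectors: the library  *)
(* spans only finite sequences, and finite-dimensionality makes the union of   *)
(* the spans of all finite sequences in P a {vspace V}.                        *)
Section Lspan.
Variables (F : fieldType) (V : vectType F).
Implicit Type P : V -> Prop.

Lemma lspan_subproof P : exists U : {vspace V}, forall v,
  v \in U <-> exists t : seq V, (forall x, x \in t -> P x) /\ v \in <<t>>%VS.
Proof.
pose q d := `[< exists t : seq V,
  (forall x, x \in t -> P x) /\ \dim <<t>>%VS = d >].
have q0 : exists d, q d.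
  by exists 0%N; apply/asboolP; exists [::]; rewrite span_nil dimv0.
have qle d : q d -> (d <= \dim {:V})%N.
  by move=> /asboolP[t [_ <-]]; apply/dimvS/subvf.
case: (ex_maxnP q0 qle) => d /asboolP[t [tP dt]] dmax.
exists <<t>>%VS => v; split=> [vt|[t' [t'P vt']]]; first by exists t.
have /dmax dle : q (\dim <<t ++ t'>>%VS).
  apply/asboolP; exists (t ++ t'); split=> // x.
  by rewrite mem_cat => /orP[/tP|/t'P].
have /eqP -> : <<t>>%VS == <<t ++ t'>>%VS.
  by rewrite eqEdim dt dle span_cat addvSl.
by rewrite span_cat; apply: subvP vt'; rewrite addvSr.
Qed.

Definition lspan P : {vspace V} := sval (cid (lspan_subproof P)).

Lemma lspanP P v : v \in lspan P <->
  exists t : seq V, (forall x, x \in t -> P x) /\ v \in <<t>>%VS.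
Proof. exact: (svalP (cid (lspan_subproof P))). Qed.

Lemma mem_lspan P v : P v -> v \in lspan P.
Proof.
move=> Pv; apply/lspanP; exists [:: v]; split; last by rewrite memv_span1.
by move=> x; rewrite inE => /eqP->.
Qed.

Lemma lspan_sub P (U : {vspace V}) :
  (forall v, P v -> v \in U) -> (lspan P <= U)%VS.
Proof.
move=> PU; apply/subvP => v /lspanP[t [tP]]; apply/subvP/span_subvP => x.
by move=> /tP/PU.
Qed.

Lemma lspan_closed P :
    P 0 -> (forall c u v, P u -> P v -> P (c *: u + v)) ->
  forall v, v \in lspan P <-> P v.
Proof.
move=> P0 Plin v; split=> [|/mem_lspan//] /lspanP[t [tP]].
elim: t tP v => [|x t IH] tP v.
  by rewrite span_nil memv0 => /eqP->.
rewrite span_cons => /memv_addP[u /vlineP[c ->] [w wt ->]].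
apply: Plin; first by apply: tP; rewrite mem_head.
by apply: IH wt => y yt; apply: tP; rewrite inE yt orbT.
Qed.

End Lspan.

(* External direct sum of a finite family of F-vector spaces. *)
Definition dsum (F : fieldType) (I : finType) (V : I -> lmodType F) :=
  {dffun forall i, V i}.

Section Dsum.
Variables (F : fieldType) (I : finType) (V : I -> lmodType F).
Local Notation D := (dsum V).
Implicit Types f g h : D.

HB.instance Definition _ := Choice.copy D {dffun forall i, V i}.

Definition dsum_zero : D := [ffun i => 0 : V i].
Definition dsum_opp f : D := [ffun i => - f i : V i].
Definition dsum_add f g : D := [ffun i => f i + g i : V i].
Definition dsum_scale c f : D := [ffun i => c *: f i : V i].

Fact dsum_addA : associative dsum_add.
Proof. by move=> f g h; apply/ffunP => i; rewrite !ffunE addrA. Qed.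
Fact dsum_addC : commutative dsum_add.
Proof. by move=> f g; apply/ffunP => i; rewrite !ffunE addrC. Qed.
Fact dsum_add0 : left_id dsum_zero dsum_add.
Proof. by move=> f; apply/ffunP => i; rewrite !ffunE add0r. Qed.
Fact dsum_addN : left_inverse dsum_zero dsum_opp dsum_add.
Proof. by move=> f; apply/ffunP => i; rewrite !ffunE addNr. Qed.

HB.instance Definition _ :=
  GRing.isZmodule.Build D dsum_addA dsum_addC dsum_add0 dsum_addN.

Fact dsum_scaleA c d f : dsum_scale c (dsum_scale d f) = dsum_scale (c * d) f.
Proof. by apply/ffunP => i; rewrite !ffunE scalerA. Qed.
Fact dsum_scale1 : left_id 1 dsum_scale.
Proof. by move=> f; apply/ffunP => i; rewrite !ffunE scale1r. Qed.
Fact dsum_scaleDr : right_distributive dsum_scale +%R.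
Proof. by move=> c f g; apply/ffunP => i; rewrite !ffunE scalerDr. Qed.
Fact dsum_scaleDl f : {morph dsum_scale^~ f : c d / c + d}.
Proof. by move=> c d; apply/ffunP => i; rewrite !ffunE scalerDl. Qed.

HB.instance Definition _ := GRing.Zmodule_isLmodule.Build F D
  dsum_scaleA dsum_scale1 dsum_scaleDr dsum_scaleDl.

End Dsum.

Section Leibniz.
Variables (F : fieldType) (L : vectType F) (mul : {bilinear L -> L -> L}).
Implicit Types (A I J U V W s : {vspace L}).

Definition left_leibniz : Prop :=
  forall x y z, mul x (mul y z) = mul (mul x y) z + mul y (mul x z).

Definition subalgebra A : Prop :=
  forall x y, x \in A -> y \in A -> mul x y \in A.

Definition ideal A I : Prop :=
  (I <= A)%VS /\
  forall x y, x \in A -> y \in I -> mul x y \in I /\ mul y x \in I.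

Definition prod_space U V : {vspace L} :=
  lspan (fun z => exists x y, [/\ x \in U, y \in V & z = mul x y]).

Definition derived_series U (n : nat) : {vspace L} :=
  iter n (fun W => prod_space W W) U.

Definition solvable U : Prop := exists n, derived_series U n = 0%VS.

(* The Leibniz kernel of the subalgebra A. *)
Definition Leib A : {vspace L} :=
  lspan (fun z => exists2 x, x \in A & z = mul x x).

Definition semisimple A : Prop :=
  forall I, ideal A I -> solvable I -> (I <= Leib A)%VS.

(* In a left Leibniz algebra, the Jacobi identity for A then follows. *)
Definition lie_subalgebra A : Prop :=
  subalgebra A /\ forall x, x \in A -> mul x x = 0.

Definition levi_factor s : Prop :=
  [/\ lie_subalgebra s, semisimple s,
      (s + Leib fullv)%VS = fullv & directv (s + Leib fullv)].

(* An ideal of s that is simple as a Lie algebra in its own right. *)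
Definition simple_ideal s I : Prop :=
  [/\ ideal s I, prod_space I I != 0%VS
    & forall J, ideal I J -> J = 0%VS \/ J = I].

(* Left s-modules below are subspaces of L, s acting by left multiplication.  *)
Definition submodule s V W : Prop :=
  (W <= V)%VS /\ forall x w, x \in s -> w \in W -> mul x w \in W.

Definition irreducible_submodule s V W : Prop :=
  [/\ submodule s V W, W != 0%VS
    & forall U, submodule s W U -> U = 0%VS \/ U = W].

Definition trivial_module s W : Prop :=
  forall x w, x \in s -> w \in W -> mul x w = 0.

(* For an s-stable U, vsproj U (mul x (vsval u)) is x.u seen in subvs_of U.   *)
Definition module_hom s U V (f : 'Hom(subvs_of U, subvs_of V)) : Prop :=
  forall x u, x \in s ->
    vsval (f (vsproj U (mul x (vsval u)))) = mul x (vsval (f u)).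

Definition module_iso s U V : Prop :=
  exists f : 'Hom(subvs_of U, subvs_of V), module_hom s f /\ bijective f.

Definition Hom_mod s U V : {vspace 'Hom(subvs_of U, subvs_of V)} :=
  lspan (@module_hom s U V).

Definition End_mod s U : {vspace 'Hom(subvs_of U, subvs_of U)} := Hom_mod s U U.

Lemma Hom_modP s U V (f : 'Hom(subvs_of U, subvs_of V)) :
  f \in Hom_mod s U V <-> module_hom s f.
Proof.
apply: lspan_closed => [x u _|c g h gP hP x u xs].
  by rewrite !lfunE /= linear0r.
by rewrite !add_lfunE !scale_lfunE !linearP /= gP // hP.
Qed.

(* V is the internal direct sum of s-submodules U i k (k < a i) with each     *)
(* U i k isomorphic to W i, that is, V is the direct sum of the (W i)^(a i).  *)
Definition isotypic_decomposition s V n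
    (W : 'I_n -> {vspace L}) (a : 'I_n -> nat) : Prop :=
  exists U : forall i, 'I_(a i) -> {vspace L},
    [/\ forall i k, submodule s V (U i k),
        forall i k, module_iso s (U i k) (W i),
        V = (\sum_i \sum_(k < a i) U i k)%VS
      & directv (\sum_i \sum_(k < a i) U i k)].

Definition derivation (D : 'End(L)) : Prop :=
  forall x y, D (mul x y) = mul (D x) y + mul x (D y).

Definition Der : {vspace 'End(L)} := lspan derivation.

Lemma DerP (D : 'End(L)) : D \in Der <-> derivation D.
Proof.
apply: lspan_closed => [x y|c D1 D2 D1P D2P x y].
  by rewrite !lfunE /= linear0l linear0r addr0.
rewrite !add_lfunE !scale_lfunE D1P D2P linearPl linearPr /=.
by rewrite scalerDr addrACA.
Qed.

End Leibniz.

(* Main.v *)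
Require Import Defs.
From HB Require Import structures.
From mathcomp Require Import all_boot all_order all_algebra all_field.
From mathcomp Require Import ring boolp.

Set Implicit Arguments.
Unset Strict Implicit.
Unset Printing Implicit Defensive.

Import Order.TTheory GRing.Theory Num.Theory.
Local Open Scope ring_scope.

(* Left multiplication by K = Leib(L) is zero and derivations preserve K, so  *)
(* a derivation D of L = s + K is determined by the s-component of its        *)
(* restriction to s, which is a derivation of s, hence ad u for some u in s,  *)
(* and by D - L_u, which is an s-module homomorphism s -> K on s and an       *)
(* s-module endomorphism of K on K. Schur's lemma and the decompositions of   *)
(* s and K do the rest.                                                       *)
(*   Derivations of s are inner because its Killing form is nondegenerate: if *)
(* R is the radical of the form, every x in [R, R] is ad-nilpotent, so R is   *)
(* solvable by Engel's theorem, hence zero. The ad-nilpotency is Cartan's     *)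
(* criterion: over a splitting field of the characteristic polynomial of      *)
(* ad x, let f be additive and integer-valued on the eigenvalues; the map Y   *)
(* equal to f(l) on the generalized eigenspace of l is a derivation, whence   *)
(* tr(Y ad x) = \sum f(l) m_l l = 0, and applying f gives \sum m_l f(l)^2 = 0.*)

(** * Linear algebra and polynomials *)

(** The isomorphism is built from the right-hand side to Der(L) and then inverted. With pi and rho
    the projections of L onto s and K, [derivation_parametrization] sends (u, t1, t2) to L_u + t1 pi
    + t2 rho, where t1 : s -> K and t2 : K -> K are the s-linear maps that [hom_glue] assembles from
    families of homomorphisms between the S i and the M j. These are derivations: L_u by the left
    Leibniz identity, and every s-linear map from L to K because K multiplies by zero on the left
    ([derivation_to_Leib]). The element u is recovered because the Killing form of s is
    nondegenerate ([killing_rad0]), and every derivation arises because those of s are inner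
    ([derivation_inner]). [schur] removes the blocks M i -> M j with i != j. The Lie theory runs
    from [split_derivation_nilp] over [sum_commutator_nilp] to [killing_rad_nilp], which together
    with [engel] gives [killing_rad0]. *)

Lemma pchar0_mulrz_eq0 (K : fieldType) (x : K) (z : int) :
  [pchar K] =i pred0 -> (x *~ z == 0) = (z == 0) || (x == 0).
Proof.
move/pcharf0P => K0; rewrite -mulrzl mulf_eq0; congr (_ || _).
by case: z => n; rewrite ?NegzE ?mulrNz ?oppr_eq0 -?pmulrn K0.
Qed.

(* Induction on ev: a new element e either satisfies e *~ N = (integer        *)
(* combination of the previous ones) with N != 0, and then f is rescaled by N,*)
(* or e is independent of them, and then f e := 0.                            *)
Lemma int_functional_cons (K : fieldType) (l : K) (ev : seq K) :
  [pchar K] =i pred0 -> l != 0 -> l \notin ev -> uniq ev ->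
  exists2 f : K -> int, f l != 0 &
    forall z : K -> int, l *~ z l + \sum_(k <- ev) k *~ z k = 0 ->
      z l * f l + \sum_(k <- ev) z k * f k = 0.
Proof.
move=> K0 l0; elim: ev => [|e ev IH] /=.
  move=> _ _; exists (fun=> 1) => // z.
  rewrite !big_nil !addr0 => /eqP; rewrite pchar0_mulrz_eq0 // (negPf l0) orbF.
  by move=> /eqP->; rewrite mul0r.
rewrite inE negb_or => /andP[le lev] /andP[eev uev].
have [f fl fP] := IH lev uev; have el : (l == e) = false by apply: negPf.
have notin k : k \in ev -> (k == e) = false.
  by move=> kev; apply: contraNF eev => /eqP<-.
have [[N [y [N0 Ey]]]|nrel] := pselect (exists N (y : K -> int),
    N != 0 /\ e *~ N = l *~ y l + \sum_(k <- ev) k *~ y k); last first.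
  exists (fun k => if k == e then 0 else f k); first by rewrite el.
  move=> z; rewrite !big_cons eqxx mulr0 add0r el => zP.
  rewrite (_ : \sum_(k <- ev) _ = \sum_(k <- ev) z k * f k); last first.
    by apply: eq_big_seq => k /notin->.
  apply: fP; have [ze0|ze] := eqVneq (z e) 0.
    by rewrite ze0 mulr0z add0r in zP.
  case: nrel; exists (- z e), z; split; first by rewrite oppr_eq0.
  by rewrite mulrNz; apply/esym/eqP; rewrite -addr_eq0 -addrA [X in _ + X]addrC zP.
pose fe := y l * f l + \sum_(k <- ev) y k * f k.
exists (fun k => if k == e then fe else N * f k).
  by rewrite el mulf_neq0.
move=> z; rewrite !big_cons eqxx el => zP.
have -> : \sum_(k <- ev) z k * (if k == e then fe else N * f k) =
          \sum_(k <- ev) (N * z k) * f k.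
  by apply: eq_big_seq => k /notin->; rewrite mulrCA mulrA.
(* N times the given relation, with [e *~ N] replaced by its expression in l and ev, no longer
   involves e. *)
have := fP (fun k => N * z k + z e * y k) _.
rewrite mulrDl (eq_bigr _ (fun k _ => mulrDl _ _ _)) big_split /= => E.
rewrite -[RHS]E; last first.
  rewrite (eq_bigr _ (fun k _ => mulrzDr _ _ _)) big_split /= mulrzDr.
  under eq_bigr do rewrite mulrC mulrzA.
  under [X in _ + (_ + X)]eq_bigr do rewrite mulrC mulrzA.
  rewrite !(mulrC _ (z l)) [z e * _]mulrC !mulrzA -!mulrz_suml.
  rewrite addrACA -!mulrzDl -Ey -mulrzA mulrC mulrzA -mulrzDl.
  by rewrite addrAC -addrA zP mul0rz.
under [X in _ = _ + (_ + X)]eq_bigr do rewrite -mulrA.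
by rewrite -mulr_sumr /fe; ring.
Qed.

(** Such an f is the restriction to ev of a homomorphism to the integers from the additive group
    generated by ev: respecting all integer relations is what makes it extend. It takes the place of
    a linear functional on the rational span of the eigenvalues. *)
Lemma int_functional (K : fieldType) (l : K) (ev : seq K) :
  [pchar K] =i pred0 -> l != 0 -> l \in ev -> uniq ev ->
  exists2 f : K -> int, f l != 0 &
    forall z : K -> int, \sum_(k <- ev) k *~ z k = 0 ->
      \sum_(k <- ev) z k * f k = 0.
Proof.
move=> K0 l0 lev uev.
have [||f fl fP] := @int_functional_cons K l (rem l ev) K0 l0.
- by rewrite mem_rem_uniq // inE eqxx.
- exact: rem_uniq.
by exists f => // z; rewrite !(big_rem l lev) /=; apply: fP.
Qed.

(** For a rank factorization A = C R, tr A = tr (R C), and R C is nilpotent of size rank A. This is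
    smaller than n unless A is invertible, and an invertible nilpotent matrix has size 0. *)
Lemma mxtrace_nilp (F : fieldType) n (A : 'M[F]_n) k :
  A ^+ k = 0 -> \tr A = 0.
Proof.
elim/ltn_ind: n A k => n IH A k Ak.
have [rn|] := ltnP (\rank A) n; last first.
  case: n A Ak {IH} => [|n] A Ak rn; first by rewrite [A]flatmx0 mxtrace0.
  have uA : A \is a GRing.unit by rewrite row_leq_rank row_free_unit in rn.
  by have := unitrX k uA; rewrite Ak unitr0.
rewrite -[A in LHS]mulmx_base mxtrace_mulC.
apply: (IH _ rn _ k.+1).
have -> : (row_base A *m col_base A) ^+ k.+1 =
          row_base A *m A ^+ k *m col_base A.
  elim: k {Ak} => [|k IHk]; first by rewrite expr1 expr0 mulmx1.
  rewrite exprSr IHk -mulmxE mulmxA -(mulmxA _ (col_base A)) mulmx_base.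
  by rewrite -(mulmxA _ (A ^+ k)) mulmxE -exprSr.
by rewrite Ak mulmx0 mul0mx.
Qed.

(** For a rank factorization P = C R of an idempotent, cancelling C and R in C R C R = C R gives R C
    = 1. *)
Lemma mxtrace_idem (F : fieldType) n (P : 'M[F]_n) :
  P *m P = P -> \tr P = (\rank P)%:R.
Proof.
move=> PP; rewrite -[P in LHS]mulmx_base mxtrace_mulC.
suff -> : row_base P *m col_base P = 1%:M by rewrite mxtrace1.
have cf : row_full (col_base P) by apply: col_base_full.
apply: (row_full_inj (col_base_full P)); apply: (row_free_inj (row_base_free P)).
by rewrite mulmx1 mulmxA mulmx_base -mulmxA mulmx_base PP.
Qed.

Lemma irreducible_factor (F : fieldType) (p : {poly F}) :
  p != 0 -> (1 < size p)%N -> exists r, irreducible_poly r /\ r %| p.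
Proof.
move=> p0 sp.
pose P k := `[< exists r : {poly F}, [/\ size r = k, (1 < k)%N & r %| p] >].
have exP : exists k, P k by exists (size p); apply/asboolP; exists p.
case: (ex_minnP exP) => k /asboolP[r [<- sr rp]] rmin.
exists r; split=> //; split=> // d sd dr; have r0 := dvdpN0 rp p0.
rewrite -dvdp_size_eqp // eqn_leq dvdp_leq // rmin //; apply/asboolP.
exists d; split; rewrite ?(dvdp_trans dr) //.
by rewrite ltn_neqAle eq_sym sd size_poly_gt0 (dvdpN0 dr).
Qed.

(** Roots are adjoined one at a time. The field grows at each step, so the induction is on a bound
    for the size of p, over all fields at once. *)
Lemma split_poly (F : fieldType) (p : {poly F}) : p != 0 ->
  exists (K : fieldType) (iota : {rmorphism F -> K}) (rs : seq K),
    map_poly iota p %= \prod_(r <- rs) ('X - r%:P).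
Proof.
move: {-1}(size p) (leqnn (size p)) => n.
elim: n F p => [|n IH] F p sp p0; first by rewrite size_poly_leq0 (negPf p0) in sp.
have [sp1|sp1] := leqP (size p) 1.
  exists F, [the {rmorphism F -> F} of idfun], [::].
  by rewrite big_nil map_poly_id // -size_poly_eq1 eqn_leq sp1 size_poly_gt0.
have [r [ri rp]] := irreducible_factor p0 sp1.
have [L _ [z rz _]] := irredp_FAdjoin ri.
pose i1 := [the {rmorphism F -> L} of in_alg L].
have pz : root (map_poly i1 p) z.
  by apply: (root_dvdp _ rz); rewrite dvdp_map.
have /factor_theorem[p' Ep] := pz.
have p'0 : p' != 0.
  by apply: contraNneq p0 => p'0; rewrite -(map_poly_eq0 i1) Ep p'0 mul0r.
have sp' : (size p' <= n)%N.
  have := size_map_poly i1 p; rewrite Ep size_mul ?polyXsubC_eq0 // size_XsubC.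
  by rewrite addn2 /= => Es; rewrite -ltnS Es.
have [K [i2 [rs Ers]]] := IH L p' sp' p'0.
exists K, [the {rmorphism F -> K} of i2 \o i1], (i2 z :: rs).
rewrite map_poly_comp Ep rmorphM /= map_polyXsubC big_cons mulrC.
exact: eqp_mull.
Qed.

(** * Nilpotency of a split derivation *)

(** Partial fractions: for a new root l, a Bezout identity a (X - l)^N + b Q = 1, with Q the product
    over the old roots, is combined with the old identity multiplied by a (X - l)^N. *)
Lemma bezout_XsubC_exp (K : fieldType) (ls : seq K) N :
  uniq ls -> ls != [::] ->
  exists u : K -> {poly K},
    \sum_(l <- ls) u l * \prod_(m <- ls | m != l) ('X - m%:P) ^+ N = 1.
Proof.
elim: ls => // l ls IH /= /andP[lls uls] _.
have notin k : k \in ls -> (k == l) = false.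
  by move=> kls; apply: contraNF lls => /eqP<-.
case: (eqVneq ls [::]) => [->|ls0].
  by exists (fun=> 1); rewrite big_seq1 big_cons eqxx /= big_nil mulr1.
have [u Eu] := IH uls ls0; set Q := \prod_(m <- ls) ('X - m%:P) ^+ N.
have : coprimep (('X - l%:P) ^+ N) Q.
  rewrite /Q big_seq; apply: (big_ind (fun q => coprimep _ q)) => [|p q cp cq|m mls].
  - exact: coprimep1.
  - by rewrite coprimepMr cp.
  - rewrite coprimep_expl // coprimep_expr // coprimep_XsubC root_XsubC.
    by rewrite notin.
case/Bezout_eq1_coprimepP => -[a b] /= ab.
exists (fun k => if k == l then b else a * u k).
rewrite big_cons eqxx big_cons eqxx /=.
have -> : \prod_(j <- ls | j != l) ('X - j%:P) ^+ N = Q.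
  by rewrite /Q big_seq_cond [RHS]big_seq_cond; apply: eq_bigl => k;
    rewrite andbT; case kls: (k \in ls) => //=; rewrite notin.
rewrite -[RHS]ab addrC; congr (_ + _).
rewrite -[RHS]mulr1 -[X in _ = _ * X]Eu mulr_sumr; apply: eq_big_seq => k kls.
by rewrite notin // big_cons eq_sym notin //=; ring.
Qed.

(** The P l are the projections onto the generalized eigenspaces, obtained by evaluating at X the
    terms of the Bezout identity. The exponent [size rs] bounds all multiplicities, so
    Cayley-Hamilton kills every multiple of the product of all (X - m)^N. *)
Lemma spectral_idempotents (K : fieldType) n (X : 'M[K]_n) (rs : seq K) :
  char_poly X %= \prod_(r <- rs) ('X - r%:P) ->
  exists P : K -> 'M[K]_n,
    [/\ \sum_(l <- undup rs) P l = 1%:M,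
        forall l, P l *m X = X *m P l,
        forall l, l \in undup rs -> P l *m (X - l%:M) ^+ size rs = 0
      & {in undup rs &, forall l m, l != m -> P l *m P m = 0}].
Proof.
(* In size 0 there are no eigenvalues, a case that the Bezout identity excludes. *)
case: n X => [|n] X Xrs.
  by exists (fun=> 0); split=> *; rewrite ?mul0mx ?mulmx0 //;
    rewrite [LHS]flatmx0 [RHS]flatmx0.
pose N := size rs; pose ev := undup rs.
have ev0 : ev != [::].
  apply: contraTneq Xrs => /undup_nil ->.
  by rewrite big_nil -size_poly_eq1 size_char_poly.
have [u Eu] := bezout_XsubC_exp N (undup_uniq rs) ev0.
pose q l := \prod_(m <- ev | m != l) ('X - m%:P) ^+ N.
have Eq l : l \in ev -> q l * ('X - l%:P) ^+ N = \prod_(m <- ev) ('X - m%:P) ^+ N.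
  move=> lev; rewrite [RHS](bigD1_seq l) ?undup_uniq //= mulrC; congr (_ * _).
have kill p : \prod_(m <- ev) ('X - m%:P) ^+ N %| p -> horner_mx X p = 0.
  move=> evp; suff : char_poly X %| p.
    by case/dvdpP => p' ->; rewrite rmorphM /= Cayley_Hamilton mulr0.
  rewrite (eqp_dvdl _ Xrs); apply: dvdp_trans evp.
  rewrite prodrXl /N; have : {subset rs <= ev} by move=> r; rewrite mem_undup.
  elim: (rs) => [|r rs' IH] sub; first by rewrite big_nil dvd1p.
  rewrite big_cons exprS dvdp_mul ?IH //; last first.
    by move=> x xrs; apply: sub; rewrite inE xrs orbT.
  rewrite (bigD1_seq r) ?undup_uniq ?dvdp_mulr //=.
  by apply: sub; rewrite mem_head.
exists (fun l => horner_mx X (u l * q l)); split.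
- by rewrite -rmorph_sum /= Eu rmorph1.
- by move=> l; apply: comm_horner_mx.
- move=> l lev.
  have -> : (X - l%:M) ^+ N = horner_mx X (('X - l%:P) ^+ N).
    by rewrite rmorphXn /= rmorphB /= horner_mx_X horner_mx_C.
  by rewrite mulmxE -rmorphM /= kill // -mulrA Eq // dvdp_mull.
- move=> l m lev mev lm; rewrite mulmxE -rmorphM /= kill //.
  rewrite mulrACA dvdp_mull // -(Eq l) //.
  by rewrite dvdp_mul // /q (big_rem l lev) /= lm dvdp_mulr.
Qed.

Section GenEig.
Variables (K : fieldType) (n : nat) (X : 'M[K]_n).

Definition geneig (a : K) (v : 'rV[K]_n) := exists k, v *m (X - a%:M) ^+ k = 0.

(** By induction on the exponent for a, v (X - a) vanishes, so v is a true eigenvector, on which (X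
    - b)^j acts as the nonzero scalar (a - b)^j. *)
Lemma geneig_disjoint a b v : a != b -> geneig a v -> geneig b v -> v = 0.
Proof.
move=> ab [k]; elim: k v => [|k IH] v; first by rewrite expr0 mulmx1.
rewrite exprS -mulmxE mulmxA => vk [m vm].
have va : v *m (X - a%:M) = 0.
  apply: IH vk _; exists m.
  rewrite -mulmxA (_ : _ *m _ ^+ m = (X - b%:M) ^+ m *m (X - a%:M)).
    by rewrite mulmxA vm mul0mx.
  have cM (Z : 'M[K]_n) c : GRing.comm Z c%:M by apply: comm_mx_scalar.
  by apply/commrX/commrB => //; apply/commr_sym/commrB.
have vX : v *m X = a *: v.
  by apply/eqP; rewrite -subr_eq0 -mul_mx_scalar -mulmxBr va.
have vb j : v *m (X - b%:M) ^+ j = (a - b) ^+ j *: v.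
  elim: j => [|j IHj]; first by rewrite mulmx1 scale1r.
  rewrite exprSr -mulmxE mulmxA IHj -scalemxAl mulmxBr vX mul_mx_scalar.
  by rewrite -scalerBl scalerA -exprSr.
move/eqP: vm; rewrite vb scaler_eq0 expf_eq0 subr_eq0 (negPf ab) andbF.
by move/eqP.
Qed.

Lemma geneig_le a (v : 'rV_n) k m : (k <= m)%N ->
  v *m (X - a%:M) ^+ k = 0 -> v *m (X - a%:M) ^+ m = 0.
Proof. by move=> /subnKC<- vk; rewrite exprD -mulmxE mulmxA vk mul0mx. Qed.

(** Reading [w *m ad v] as the product v w, the hypothesis says that X is a derivation. Hence (v
    w)(X - (a + b)) = (v (X - a)) w + v (w (X - b)), and the induction is on the sum of the two
    exponents. *)
Lemma geneig_mul (ad : {linear 'rV[K]_n -> 'M[K]_n}) a b v w :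
  (forall v, ad (v *m X) = ad v *m X - X *m ad v) ->
  geneig a v -> geneig b w -> geneig (a + b) (w *m ad v).
Proof.
move=> adX [k vk] [m wm]; move: {-1}(k + m)%N (leqnn (k + m)%N) => d.
elim: d k m v w vk wm => [|d IH] k m v w vk wm kmd.
  have k0 : k = 0%N by apply/eqP; rewrite -leqn0 (leq_trans (leq_addr _ _) kmd).
  by exists 0%N; move: vk; rewrite k0 expr0 !mulmx1 => ->; rewrite linear0 mulmx0.
case: k vk kmd => [|k] vk kmd.
  by exists 0%N; move: vk; rewrite expr0 !mulmx1 => ->; rewrite linear0 mulmx0.
case: m wm kmd => [|m] wm kmd.
  by exists 0%N; move: wm; rewrite expr0 !mulmx1 => ->; rewrite mul0mx.
have [i1 E1] : geneig (a + b) (w *m ad (v *m (X - a%:M))).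
  apply: (IH k m.+1 _ w _ wm); last by move: kmd; rewrite addSn ltnS.
  by rewrite -mulmxA mulmxE -exprS.
have [i2 E2] : geneig (a + b) (w *m (X - b%:M) *m ad v).
  apply: (IH k.+1 m v _ vk); last by move: kmd; rewrite addnS ltnS.
  by rewrite -mulmxA mulmxE -exprS.
exists (maxn i1 i2).+1; rewrite exprS -mulmxE mulmxA.
have -> : w *m ad v *m (X - (a + b)%:M) =
          w *m ad (v *m (X - a%:M)) + w *m (X - b%:M) *m ad v.
  rewrite !mulmxBr !mul_mx_scalar linearB /= [ad (_ *: _)]linearZ /= adX.
  rewrite !mulmxBr mulmxBl !mulmxA -scalemxAr -scalemxAl scalerDl opprD.
  by rewrite [X in _ = X + _]addrAC !addrA subrK.
rewrite mulmxDl (geneig_le (leq_maxl _ _) E1) (geneig_le (leq_maxr _ _) E2).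
by rewrite addr0.
Qed.

End GenEig.

Lemma split_derivation_nilp (K : fieldType) n
    (ad : {linear 'rV[K]_n -> 'M[K]_n}) (X : 'M[K]_n) (rs : seq K) :
  [pchar K] =i pred0 ->
  char_poly X %= \prod_(r <- rs) ('X - r%:P) ->
  (forall v, ad (v *m X) = ad v *m X - X *m ad v) ->
  (forall Y, (forall v, ad (v *m Y) = ad v *m Y - Y *m ad v) ->
     \tr (Y *m X) = 0) ->
  exists k, X ^+ k = 0.
Proof.
move=> K0 Xrs adX trX; have [P [P1 PX PN PP]] := spectral_idempotents Xrs.
pose ev := undup rs; have uev : uniq ev := undup_uniq rs.
have PK l : l \in ev -> P l *m P l = P l.
  move=> lev; rewrite -[RHS]mulmx1 -P1 mulmx_sumr (bigD1_seq l) //=.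
  rewrite big_seq_cond big1 ?addr0 // => m /andP[mev ml].
  by rewrite PP // eq_sym.
have sumE (v : 'rV_n) : v = \sum_(l <- ev) v *m P l.
  by rewrite -mulmx_sumr P1 mulmx1.
have PG l v : l \in ev -> geneig X l (v *m P l).
  by move=> lev; exists (size rs); rewrite -mulmxA PN // mulmx0.
have PGg l g v : geneig X g v -> geneig X g (v *m P l).
  move=> [k vk]; exists k; rewrite -mulmxA (_ : P l *m _ = (X - g%:M) ^+ k *m P l).
    by rewrite mulmxA vk mul0mx.
  have cM c : GRing.comm (P l) c%:M by apply: comm_mx_scalar.
  by apply/commrX/commrB => //; apply: PX.
(* All components of v other than the one at g lie in two different generalized eigenspaces, so they
   vanish. *)
have Pg g v : geneig X g v -> v = if g \in ev then v *m P g else 0.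
  move=> vg; have z l : l \in ev -> l != g -> v *m P l = 0.
    by move=> lev lg; apply: (geneig_disjoint lg (PG _ _ lev) (PGg _ _ _ vg)).
  rewrite [LHS]sumE; case: ifPn => gev.
    rewrite (bigD1_seq g) //= big_seq_cond big1 ?addr0 // => l /andP[lev lg].
    exact: z.
  by rewrite big_seq big1 // => l lev; apply: z => //; apply: contraNneq gev => <-.
(* If only the eigenvalue 0 survives, a power of X is killed by every P l, and these sum to 1. *)
suff P0 l : l \in ev -> l != 0 -> P l = 0.
  exists (size rs); rewrite -[LHS]mul1mx -P1 mulmx_suml big_seq big1 // => l lev.
  have [l0|/(P0 _ lev)->] := eqVneq l 0; last by rewrite mul0mx.
  by have := PN _ lev; rewrite l0 raddf0 subr0.
move=> lev l0; have [f fl fP] := int_functional K0 l0 lev uev.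
(* f is applied to the relation a + b - (a + b) = 0, whose weights are sums of indicators, so that
   coincidences among a, b and a + b do no harm. *)
have fD a b : a \in ev -> b \in ev -> a + b \in ev -> f (a + b) = f a + f b.
  move=> aev bev abev.
  have pick (c : K) (V : zmodType) (g : K -> V) :
      c \in ev -> \sum_(k <- ev) g k *~ (k == c)%:Z = g c.
    move=> cev; rewrite (bigD1_seq c) //= eqxx big1 ?addr0 // => k /negPf->.
    by rewrite mulr0z.
  have := fP (fun k => (k == a)%:Z + (k == b)%:Z - (k == a + b)%:Z).
  under eq_bigr do rewrite mulrzBr mulrzDr.
  rewrite sumrB big_split /= !(pick _ _ id) // subrr => /(_ erefl).
  under eq_bigr do rewrite mulrC -mulrzz mulrzBr mulrzDr.
  by rewrite sumrB big_split /= !pick // => /eqP; rewrite subr_eq0 => /eqP.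
have [Y YE] : exists Y, Y = \sum_(m <- ev) (f m)%:~R *: P m by eexists.
have GY g v : geneig X g v -> v *m Y = (f g)%:~R *: v.
  move=> vg; have := Pg _ _ vg.
  case: ifPn => gev Ev; last by rewrite Ev mul0mx scaler0.
  rewrite YE [v in LHS]Ev mulmx_sumr (bigD1_seq g) //= big_seq_cond big1 ?addr0.
    by rewrite -scalemxAr -mulmxA PK // -Ev.
  move=> m /andP[mev mg]; rewrite -scalemxAr -mulmxA PP ?mulmx0 ?scaler0 //.
  by rewrite eq_sym.
(* It suffices to test on generalized eigenvectors for a and b. Their product is one for a + b:
   either f is additive there, or a + b is not an eigenvalue and the product is zero. *)
have YD v : ad (v *m Y) = ad v *m Y - Y *m ad v.
  apply/row_matrixP => i; rewrite !rowE; move: (delta_mx 0 i : 'rV_n) => w.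
  rewrite [v]sumE mulmx_suml ![ad (\sum_(_ <- _) _)]linear_sum /=.
  rewrite mulmx_suml !mulmx_sumr -sumrB mulmx_sumr; apply: eq_big_seq => a aev.
  rewrite [w]sumE !mulmx_suml; apply: eq_big_seq => b bev.
  have va := PG a v aev; have wb := PG b w bev.
  have vw := geneig_mul adX va wb.
  rewrite mulmxBr !mulmxA (GY _ _ wb) (GY _ _ va) linearZ_LR /=.
  rewrite -scalemxAr -scalemxAl (GY _ _ vw).
  have [abev|abev] := boolP (a + b \in ev).
    by rewrite fD // rmorphD /= scalerDl addrK.
  by rewrite (Pg _ _ vw) (negPf abev) !scaler0 subrr.
(* P m X differs from m P m by P m (X - m), which is nilpotent. *)
have trP m : m \in ev -> \tr (P m *m X) = m * (\rank (P m))%:R.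
  move=> mev; rewrite -mxtrace_idem ?PK // -mxtraceZ -mul_mx_scalar.
  apply/eqP; rewrite -subr_eq0 -raddfB -mulmxBr /=; apply/eqP.
  apply: (@mxtrace_nilp _ _ _ (size rs).+1); rewrite mulmxE exprMn_comm.
    by rewrite !exprSr mulrA -(mulrA _ (P m)) -mulmxE PN // mulmx0 mul0mx.
  by apply: commrB; [apply: PX | apply: comm_mx_scalar].
(* tr (Y X) = 0 is an integer relation among the eigenvalues with weights rank (P m) f(m), to which
   f is applied. *)
have : \sum_(m <- ev) (\rank (P m))%:Z * f m * f m = 0.
  apply: fP; rewrite -[RHS](trX Y YD) YE mulmx_suml raddf_sum /=; apply: eq_big_seq => m mev.
  by rewrite -scalemxAl mxtraceZ trP // mulrzA -pmulrn mulr_natr mulrzl.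
move/eqP; rewrite psumr_eq0 => [/allP/(_ _ lev)/implyP/(_ isT)|m _]; last first.
  by rewrite -mulrA mulr_ge0 // -expr2 sqr_ge0.
rewrite !mulf_eq0 (negPf fl) !orbF eqz_nat mxrank_eq0.
by move/eqP.
Qed.

(** * Engel's theorem *)

Section BaseChange.
Variables (F K : fieldType) (iota : {rmorphism F -> K}) (n : nat).
Variable ad : {linear 'rV[F]_n -> 'M[F]_n}.

Definition ad_ext (v : 'rV[K]_n) : 'M[K]_n :=
  \sum_i v 0 i *: map_mx iota (ad (delta_mx 0 i)).

Fact ad_ext_is_linear : linear ad_ext.
Proof.
move=> c u v; rewrite /ad_ext scaler_sumr -big_split /=.
by apply: eq_bigr => i _; rewrite !mxE scalerDl scalerA.
Qed.
HB.instance Definition _ := GRing.isLinear.Build K _ _ _ ad_ext ad_ext_is_linear.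

Lemma ad_ext_map v : ad_ext (map_mx iota v) = map_mx iota (ad v).
Proof.
rewrite [in RHS](row_sum_delta v) linear_sum raddf_sum /=.
by apply: eq_bigr => i _; rewrite mxE linearZ map_mxZ.
Qed.

End BaseChange.

(** For a derivation Y over the splitting field, tr (Y [ad t, ad r]) = tr ([Y, ad t] ad r) = - tr
    (ad (t Y) ad r). This is zero because the trace condition on r extends linearly from F, so
    [split_derivation_nilp] applies. *)
Lemma sum_commutator_nilp (F : fieldType) n
    (ad : {linear 'rV[F]_n -> 'M[F]_n}) (X : 'M[F]_n)
    (I : Type) (ts : seq I) (t r : I -> 'rV[F]_n) :
  [pchar F] =i pred0 ->
  (forall v, ad (v *m X) = ad v *m X - X *m ad v) ->
  X = \sum_(k <- ts) (ad (t k) *m ad (r k) - ad (r k) *m ad (t k)) ->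
  (forall k w, \tr (ad w *m ad (r k)) = 0) ->
  exists k, X ^+ k = 0.
Proof.
move=> F0 adX EX trX.
have [K [iota [rs Xrs]]] := split_poly (monic_neq0 (char_poly_monic X)).
suff [k Xk] : exists k, map_mx iota X ^+ k = 0.
  exists k; apply/eqP; rewrite -(map_mx_eq0 iota).
  by rewrite (_ : map_mx iota (X ^+ k) = map_mx iota X ^+ k) ?Xk // rmorphXn.
apply: (@split_derivation_nilp _ _ (ad_ext iota ad) _ rs).
- by move=> p; rewrite (fmorph_pchar iota).
- by rewrite -map_char_poly.
- move=> v /=; rewrite [v]row_sum_delta mulmx_suml.
  rewrite ![ad_ext iota ad (\sum_(_ <- _) _)]raddf_sum /= mulmx_suml mulmx_sumr.
  rewrite -sumrB; apply: eq_bigr => i _.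
  rewrite -scalemxAl ![ad_ext iota ad (_ *: _)]linearZ /= -scalemxAl -scalemxAr -scalerBr; congr (_ *: _).
  rewrite -(map_delta_mx iota) -map_mxM !ad_ext_map adX.
  by rewrite raddfB /= !map_mxM.
- move=> Y /= YD; rewrite EX raddf_sum mulmx_sumr raddf_sum big1 //= => k _.
  rewrite map_mxB !map_mxM -!ad_ext_map mulmxBr !mulmxA raddfB /=.
  rewrite [X in _ - X]mxtrace_mulC mulmxA -raddfB -mulmxBl /=.
  rewrite -opprB -YD mulNmx raddfN /= ad_ext_map.
  rewrite {1}/ad_ext mulmx_suml [\tr _]raddf_sum /= big1 ?oppr0 // => i _.
  by rewrite -scalemxAl mxtraceZ -map_mxM trace_map_mx trX rmorph0 mulr0.
Qed.

(** * Nil actions and solvability *)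

Section Engel.
Variables (F : fieldType) (L : vectType F) (mul : {bilinear L -> L -> L}).
Implicit Types (x y z : L) (U V W h I s : {vspace L}).

Lemma mem_prod U V x y : x \in U -> y \in V -> mul x y \in prod_space mul U V.
Proof. by move=> xU yV; apply: mem_lspan; exists x, y. Qed.

Lemma prod_subP U V W :
  (forall x y, x \in U -> y \in V -> mul x y \in W) ->
  (prod_space mul U V <= W)%VS.
Proof. by move=> UVW; apply: lspan_sub => _ [x [y [xU yV ->]]]; apply: UVW. Qed.

Lemma prodS U U' V V' : (U <= U')%VS -> (V <= V')%VS ->
  (prod_space mul U V <= prod_space mul U' V')%VS.
Proof.
move=> UU VV; apply: prod_subP => x y xU yV.
by apply: mem_prod; [apply: subvP xU | apply: subvP yV].
Qed.

Lemma prodv0 U : prod_space mul U 0%VS = 0%VS.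
Proof.
apply/eqP; rewrite -subv0; apply: prod_subP => x y _.
by rewrite !memv0 => /eqP->; rewrite linear0r.
Qed.

Lemma prod0v U : prod_space mul 0%VS U = 0%VS.
Proof.
apply/eqP; rewrite -subv0; apply: prod_subP => x y.
by rewrite !memv0 => /eqP-> _; rewrite linear0l.
Qed.

(* Equivalent to the nilpotency of the associative algebra of operators on s  *)
(* generated by the left multiplications by elements of h.                    *)
Definition nil_action s h :=
  forall W, (W <= s)%VS -> prod_space mul h W = W -> W = 0%VS.

(** The derived series lies inside the lower central series [C], whose dimension drops strictly
    until it reaches 0, since a stable nonzero term would contradict [nil_action]. *)
Lemma nil_action_solvable s I :
  (I <= s)%VS -> subalgebra mul I -> nil_action s I -> solvable mul I.
Proof.
move=> Is Isub Inil; pose C n := iter n (prod_space mul I) I.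
have CS n : (C n.+1 <= C n)%VS.
  by elim: n => [|n IH]; [apply: prod_subP | apply: prodS IH].
have CI n : (C n <= I)%VS.
  by elim: n => // n IH; apply: subv_trans (CS n) IH.
have dimC n : (\dim (C n) + n <= \dim I)%N \/ C n = 0%VS.
  elim: n => [|n [IH|IH]]; first by left; rewrite addn0.
    have [CE|ne] := eqVneq (C n.+1) (C n).
      by right; rewrite CE; apply: Inil CE; apply: subv_trans (CI n) Is.
    left; apply: leq_trans IH; rewrite addnS -addSn leq_add2r.
    by rewrite ltnNge; apply: contra ne => Cle; rewrite eqEdim CS.
  by right; rewrite /C /= -/(C n) IH prodv0.
have DC n : (derived_series mul I n <= C n)%VS.
  by elim: n => // n IH; exact: (prodS (subv_trans IH (CI n)) IH).
exists (\dim I).+1; apply/eqP; rewrite -subv0.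
have [|<-//] := dimC (\dim I).+1.
by rewrite addnS ltnNge leq_addl.
Qed.

(** If W = (h + x) W, then U = h W is x-stable because x normalizes h. Iterating W = U + x W gives W
    = U + x^k W = U, so W = h W and W = 0. *)
Lemma engel_step s h x :
  left_leibniz mul ->
  (forall a, a \in h -> mul x a \in h) ->
  (exists k, forall y, y \in s -> iter k (mul x) y = 0) ->
  nil_action s h -> nil_action s (h + <[x]>)%VS.
Proof.
move=> leib xh [k xk] nilh W Ws EW.
have hW a w : a \in (h + <[x]>)%VS -> w \in W -> mul a w \in W.
  by move=> ah wW; rewrite -EW mem_prod.
have hh a : a \in h -> a \in (h + <[x]>)%VS by apply: subvP (addvSl _ _) _.
have xx : x \in (h + <[x]>)%VS.
  by apply: subvP (addvSr _ _) _ _; rewrite memv_line.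
have hWW : (prod_space mul h W <= W)%VS.
  by apply: prod_subP => a w ah; apply/hW/hh.
pose U := prod_space mul h W.
have xU u : u \in U -> mul x u \in U.
  move=> uU; have : (U <= linfun (mul x) @^-1: U)%VS.
    apply: prod_subP => a w ah wW; rewrite -memv_preim lfunE /= leib.
    by rewrite rpredD // mem_prod ?xh ?hW.
  by move/subvP/(_ _ uU); rewrite -memv_preim lfunE.
have dec j w : w \in W -> exists u w', [/\ u \in U, w' \in W &
    w = u + iter j (mul x) w'].
  elim: j w => [|j IH] w wW; first by exists 0, w; rewrite mem0v add0r.
  have : (W <= U + linfun (mul x) @: W)%VS.
    rewrite -{1}EW; apply: prod_subP => a v /memv_addP[a' a'h [b /vlineP[c ->] ->]] vW.
    rewrite linearDl linearZl_LR memv_add ?mem_prod ?rpredZ //=.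
    by apply/memv_imgP; exists v; rewrite ?lfunE.
  move/subvP/(_ w wW)/memv_addP=> [u uU [_ /memv_imgP[v vW ->] ->]].
  have [u' [w' [u'U w'W ->]]] := IH v vW.
  exists (u + mul x u'), w'; rewrite rpredD ?xU //; split=> //.
  by rewrite lfunE /= linearDr addrA.
apply: nilh => //; apply/eqP; rewrite eqEsubv hWW.
apply/subvP => w /(dec k)[u [w' [uU w'W ->]]].
by rewrite xk ?addr0 // (subvP Ws).
Qed.

(** Take a subalgebra h of I of largest dimension with nil action. If h is not I, take an h-stable T
    in I of least dimension among those not contained in h. Then h T lies in h, for otherwise
    minimality gives h T = T and the nil action T = 0. Thus any x in T outside h normalizes h, and
    [engel_step] enlarges h. *)
Lemma engel s I :
  left_leibniz mul -> (I <= s)%VS -> subalgebra mul I ->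
  (forall x, x \in I -> mul x x = 0) ->
  (forall x, x \in I -> exists k, forall y, y \in s -> iter k (mul x) y = 0) ->
  nil_action s I.
Proof.
move=> leib Is Isub Ialt Inil.
have Ianti x y : x \in I -> y \in I -> mul x y = - mul y x.
  move=> xI yI; apply/eqP; rewrite -addr_eq0.
  have := Ialt _ (rpredD xI yI).
  by rewrite linearDl !linearDr !Ialt // addr0 add0r => ->.
pose P d := `[< exists h, [/\ \dim h = d, (h <= I)%VS, subalgebra mul h
  & nil_action s h] >].
have P0 : exists d, P d.
  exists 0%N; apply/asboolP; exists 0%VS; split; rewrite ?dimv0 ?sub0v //.
    by move=> x y; rewrite !memv0 => /eqP-> _; rewrite linear0l.
  by move=> W _; rewrite prod0v.
have Ple d : P d -> (d <= \dim I)%N by move=> /asboolP[h [<- hI _ _]]; apply: dimvS.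
case: (ex_maxnP P0 Ple) => d /asboolP[h [dh hI hsub hnil]] hmax.
have [hIe|] := boolP (I <= h)%VS.
  by have <- : h = I by apply/eqP; rewrite eqEsubv hI.
move=> Ih; exfalso.
pose Q d := `[< exists T, [/\ \dim T = d, (T <= I)%VS, ~~ (T <= h)%VS
  & (prod_space mul h T <= T)%VS] >].
have Q0 : exists d, Q d.
  exists (\dim I); apply/asboolP; exists I; split => //.
  by apply: prod_subP => a b ah bI; rewrite Isub // (subvP hI).
case: (ex_minnP Q0) => e /asboolP[T [eT TI Th hT]] Tmin.
have hTh : (prod_space mul h T <= h)%VS.
  apply: contraNT Th => nh.
  have TT : prod_space mul h T = T.
    apply/eqP; rewrite eqEdim hT eT Tmin //; apply/asboolP.
    exists (prod_space mul h T); split=> //; first exact: subv_trans TI.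
    exact: prodS.
  by rewrite (hnil T) ?sub0v //; apply: subv_trans Is.
have /subvPn[x xT xh] := Th.
have xI := subvP TI x xT.
have hx a : a \in h -> mul a x \in h.
  by move=> ah; apply: (subvP hTh); apply: mem_prod.
have xh' a : a \in h -> mul x a \in h.
  by move=> ah; rewrite Ianti ?rpredN ?hx // (subvP hI).
have /hmax : P (\dim (h + <[x]>)).
  apply/asboolP; exists (h + <[x]>)%VS; split => //.
  - by rewrite subv_add hI -memvE.
  - move=> y z /memv_addP[a ah [_ /vlineP[c ->] ->]].
    move=> /memv_addP[b bh [_ /vlineP[c' ->] ->]].
    apply: (subvP (addvSl _ _)).
    rewrite linearDl !linearDr /= !linearZl_LR !linearZr_LR /= Ialt //.
    by rewrite !scaler0 addr0 !rpredD ?rpredZ ?hx ?xh' ?hsub.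
  - by apply: engel_step => //; apply: Inil.
rewrite -dh => dle; case/negP: xh; rewrite memvE.
have /eqP -> : h == (h + <[x]>)%VS by rewrite eqEdim addvSl.
exact: addvSr.
Qed.

End Engel.

(** * The Killing form and inner derivations *)

Section Restriction.
Variables (F : fieldType) (L : vectType F) (s : {vspace L}).
Implicit Types (f g : 'End(L)) (v : L) (r : 'rV[F]_(\dim s)).

Definition vcoord v : 'rV[F]_(\dim s) := \row_j coord (vbasis s) j v.

Definition vlin r : L := \sum_j r 0 j *: (vbasis s)`_j.

(** Matrices act on row vectors, so composition reverses products. This is the matrix of the
    restriction of f only when f preserves s. *)
Definition mxs f : 'M[F]_(\dim s) :=
  \matrix_(i, j) coord (vbasis s) j (f (vbasis s)`_i).

Fact vcoord_is_linear : linear vcoord.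
Proof. by move=> c u v; apply/rowP => j; rewrite !mxE linearP. Qed.
HB.instance Definition _ := GRing.isLinear.Build F _ _ _ vcoord vcoord_is_linear.

Fact vlin_is_linear : linear vlin.
Proof.
move=> c u v; rewrite /vlin scaler_sumr -big_split /=.
by apply: eq_bigr => i _; rewrite !mxE scalerDl scalerA.
Qed.
HB.instance Definition _ := GRing.isLinear.Build F _ _ _ vlin vlin_is_linear.

Fact mxs_is_linear : linear mxs.
Proof. by move=> c f g; apply/matrixP => i j; rewrite !mxE !lfunE /= !lfunE linearP. Qed.
HB.instance Definition _ := GRing.isLinear.Build F _ _ _ mxs mxs_is_linear.

Lemma mem_vbasis_nth i : (i < \dim s)%N -> (vbasis s)`_i \in s.
Proof. by move=> i_lt; rewrite vbasis_mem // mem_nth ?size_tuple. Qed.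

Lemma vlin_mem r : vlin r \in s.
Proof. by apply: rpred_sum => i _; rewrite rpredZ ?mem_vbasis_nth. Qed.

Lemma vcoordK v : v \in s -> vlin (vcoord v) = v.
Proof.
move=> vs; rewrite [RHS](coord_vbasis vs).
by apply: eq_bigr => i _; rewrite mxE.
Qed.

Lemma vlinK r : vcoord (vlin r) = r.
Proof.
apply/rowP => j; rewrite mxE coord_sum_free //.
by have /andP[] := vbasisP s.
Qed.

Lemma vcoord_mxs f v : v \in s -> vcoord v *m mxs f = vcoord (f v).
Proof.
move=> vs; apply/rowP => j; rewrite !mxE [in RHS](coord_vbasis vs) !linear_sum /=.
by apply: eq_bigr => i _; rewrite !mxE !linearZ.
Qed.

Lemma eq_mxs f g : {in s, f =1 g} -> mxs f = mxs g.
Proof. by move=> fg; apply/matrixP => i j; rewrite !mxE fg ?mem_vbasis_nth. Qed.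

Lemma mxs_comp f g : (forall v, v \in s -> f v \in s) ->
  mxs (g \o f)%VF = mxs f *m mxs g.
Proof.
move=> fs; apply/row_matrixP => i; rewrite row_mul.
have rE h : row i (mxs h) = vcoord (h (vbasis s)`_i).
  by apply/rowP => j; rewrite !mxE.
by rewrite !rE vcoord_mxs ?fs ?mem_vbasis_nth // lfunE.
Qed.

End Restriction.

Lemma mxtrace_commutator (F : fieldType) n (X Y Z : 'M[F]_n) :
  \tr ((X *m Y - Y *m X) *m Z) = \tr (X *m (Y *m Z - Z *m Y)).
Proof. by rewrite mulmxBl mulmxBr !linearB /= -!mulmxA (mxtrace_mulC Y) -!mulmxA. Qed.

Section Killing.
Variables (F : fieldType) (L : vectType F) (mul : {bilinear L -> L -> L}).
Variable s : {vspace L}.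
Hypotheses (F0 : [pchar F] =i pred0) (leib : left_leibniz mul).
Hypotheses (s_sub : subalgebra mul s) (s_alt : forall x, x \in s -> mul x x = 0).
Hypothesis s_ss : forall I, ideal mul s I -> solvable mul I -> I = 0%VS.
Implicit Types (x y : L) (d : 'End(L)).

Definition adm x := mxs s (linfun (mul x)).

Fact adm_is_linear : linear adm.
Proof.
move=> c x y; rewrite /adm -linearP; apply: eq_mxs => v _.
by rewrite add_lfunE scale_lfunE !lfunE /= linearPl.
Qed.
HB.instance Definition _ := GRing.isLinear.Build F _ _ _ adm adm_is_linear.

Lemma s_anti x y : x \in s -> y \in s -> mul x y = - mul y x.
Proof.
move=> xs ys; apply/eqP; rewrite -addr_eq0.
have := s_alt (rpredD xs ys).
by rewrite linearDl !linearDr !s_alt // addr0 add0r => ->.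
Qed.

Definition der_on d := (forall x, x \in s -> d x \in s) /\
  (forall x y, x \in s -> y \in s -> d (mul x y) = mul (d x) y + mul x (d y)).

Lemma der_on_mul x : x \in s -> der_on (linfun (mul x)).
Proof.
move=> xs; split=> [y ys|y z _ _]; first by rewrite lfunE /= s_sub.
by rewrite !lfunE /= leib.
Qed.

(** This is ad (d x) = [d, ad x], with the commutator reversed by the row-vector convention. *)
Lemma adm_der d x : der_on d -> x \in s ->
  adm (d x) = adm x *m mxs s d - mxs s d *m adm x.
Proof.
move=> [ds dm] xs; rewrite -!mxs_comp //; last first.
  by move=> y ys; rewrite lfunE /= s_sub.
rewrite -linearB; apply: eq_mxs => y ys.
by rewrite !lfunE /= !lfunE /= !lfunE /= !lfunE /= dm // addrK.
Qed.

Lemma adm_mul x y : x \in s -> y \in s ->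
  adm (mul x y) = adm y *m adm x - adm x *m adm y.
Proof. by move=> xs ys; have := adm_der (der_on_mul xs) ys; rewrite lfunE. Qed.

Definition killing_rad : {vspace L} :=
  lspan (fun x => x \in s /\ forall y, y \in s -> \tr (adm x *m adm y) = 0).

Lemma killing_radP x : x \in killing_rad <->
  x \in s /\ forall y, y \in s -> \tr (adm x *m adm y) = 0.
Proof.
apply: lspan_closed => [|c u v [us uk] [vs vk]].
  by split=> [|y _]; rewrite ?mem0v // linear0 mul0mx mxtrace0.
split=> [|y ys]; first by rewrite rpredD ?rpredZ.
by rewrite linearP mulmxDl -scalemxAl mxtraceD mxtraceZ uk ?vk // mulr0 addr0.
Qed.

Lemma killing_rad_sub : (killing_rad <= s)%VS.
Proof. by apply/subvP => x /killing_radP[]. Qed.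

Lemma killing_rad_der d x : der_on d -> x \in killing_rad -> d x \in killing_rad.
Proof.
move=> dd /killing_radP[xs xk]; have ds := dd.1; apply/killing_radP.
split=> [|y ys]; first exact: ds.
rewrite adm_der // mxtrace_commutator.
have -> : mxs s d *m adm y - adm y *m mxs s d = - adm (d y).
  by rewrite adm_der // opprB.
by rewrite mulmxN raddfN /= xk ?oppr0 ?ds.
Qed.

Lemma killing_rad_ideal : ideal mul s killing_rad.
Proof.
split=> [|x y xs yR]; first exact: killing_rad_sub.
have xy : mul x y \in killing_rad.
  by have := killing_rad_der (der_on_mul xs) yR; rewrite lfunE.
by split=> //; rewrite s_anti ?rpredN // (subvP killing_rad_sub).
Qed.

(** x is a sum of products of elements of the radical, so [adm x] is a sum of commutators as
    required by [sum_commutator_nilp]. Scalars are absorbed into the first factor of each pair. *)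
Lemma killing_rad_nilp x : x \in prod_space mul killing_rad killing_rad ->
  exists k, forall y, y \in s -> iter k (mul x) y = 0.
Proof.
have RS := subvP killing_rad_sub.
move=> xI; have xs : x \in s.
  apply: subvP xI; apply: prod_subP => a b /RS a_s /RS bs; exact: s_sub.
pose T := {p : L * L | (p.1 \in killing_rad) && (p.2 \in killing_rad)}.
pose P x := exists ts : seq T, adm x = \sum_(k <- ts)
   (adm (val k).2 *m adm (val k).1 - adm (val k).1 *m adm (val k).2).
have [ts Ets] : P x.
  apply: (iffLR (lspan_closed _ _ x) (subvP _ x xI)).
  - by exists [::]; rewrite big_nil linear0.
  - move=> c u v [tu Eu] [tv Ev].
    have sc (k : T) : (c *: (val k).1 \in killing_rad) && ((val k).2 \in killing_rad).
      by have /andP[k1 k2] := valP k; rewrite rpredZ.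
    exists (map (fun k => Sub (c *: (val k).1, (val k).2) (sc k) : T) tu ++ tv).
    rewrite big_cat big_map -Ev linearP /= Eu scaler_sumr; congr (_ + _).
    apply: eq_bigr => k _ /=.
    by rewrite linearZ -scalemxAr -scalemxAl scalerBr.
  - apply: lspan_sub => _ [a [b [aR bR ->]]]; apply: mem_lspan.
    have ab : ((a, b).1 \in killing_rad) && ((a, b).2 \in killing_rad).
      by rewrite aR.
    by exists [:: (Sub (a, b) ab : T)]; rewrite big_seq1 /= adm_mul ?RS.
have [k Xk] : exists k, adm x ^+ k = 0.
  pose ad := [the {linear 'rV[F]_(\dim s) -> 'M[F]_(\dim s)} of adm \o vlin (s := s)].
  apply: (@sum_commutator_nilp _ _ ad _ T ts (fun k => vcoord s (val k).2)
    (fun k => vcoord s (val k).1) F0).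
  - move=> v /=; rewrite -adm_mul ?vlin_mem //; congr adm.
    rewrite -[v in LHS](vlinK (s := s)) vcoord_mxs ?vlin_mem // vcoordK ?lfunE //=.
    by rewrite s_sub ?vlin_mem.
  - rewrite Ets; apply: eq_bigr => k _ /=; have /andP[/RS k1 /RS k2] := valP k.
    by rewrite !vcoordK.
  - move=> k w /=; have /andP[k1 _] := valP k.
    rewrite vcoordK ?RS // mxtrace_mulC.
    by case/killing_radP: k1 => _ ->; rewrite ?vlin_mem.
exists k => y ys.
have itS j : iter j (mul x) y \in s by elim: j => //= j IH; apply: s_sub.
have itE j : vcoord s (iter j (mul x) y) = vcoord s y *m adm x ^+ j.
  elim: j => [|j IH]; first by rewrite expr0 mulmx1.
  by rewrite exprSr -mulmxE mulmxA -IH vcoord_mxs // lfunE.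
by rewrite -[LHS](vcoordK (itS k)) itE Xk mulmx0 linear0.
Qed.

(** [R, R] is solvable by [killing_rad_nilp] and Engel's theorem, so R is a solvable ideal of
    derived length at most one more. *)
Lemma killing_rad0 : killing_rad = 0%VS.
Proof.
apply: s_ss killing_rad_ideal _; set R := killing_rad.
have [RS Rid] := killing_rad_ideal; have RSP := subvP RS.
pose I := prod_space mul R R.
have IR : (I <= R)%VS by apply: prod_subP => x y /RSP xs yR; have [] := Rid x y xs yR.
have Is := subv_trans IR RS.
have Isub : subalgebra mul I.
  by move=> x y xI yI; apply: mem_prod; apply: (subvP IR).
have [|n In] := nil_action_solvable Is Isub.
  apply: engel => // x xI; first by apply: s_alt; apply: (subvP Is).
  exact: killing_rad_nilp.
by exists n.+1; rewrite /derived_series iterSr.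
Qed.

(** Once the form is nondegenerate, some u satisfies tr (d ad y) = tr (ad u ad y) for all y in s.
    For e = d - ad u, invariance of the trace turns tr (ad (e x) ad y) into a trace of e against the
    adjoint of a product of x and y, which is zero. So e x lies in the radical. *)
Lemma derivation_inner d : der_on d ->
  exists2 u, u \in s & forall x, x \in s -> d x = mul u x.
Proof.
move=> dd; pose n := \dim s.
pose G : 'M[F]_n := \matrix_(i, j)
  \tr (adm (vbasis s)`_i *m adm (vbasis s)`_j).
pose l : 'rV[F]_n := \row_j \tr (mxs s d *m adm (vbasis s)`_j).
have rG (r : 'rV_n) j : (r *m G) 0 j = \tr (adm (vlin r) *m adm (vbasis s)`_j).
  rewrite mxE linear_sum mulmx_suml raddf_sum /=.
  by apply: eq_bigr => i _; rewrite mxE linearZ -scalemxAl mxtraceZ.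
have ext f : (forall j : 'I_n, \tr (f *m adm (vbasis s)`_j) = 0) ->
    forall y, y \in s -> \tr (f *m adm y) = 0.
  move=> fj y ys; rewrite (coord_vbasis ys) linear_sum mulmx_sumr raddf_sum big1 //=.
  by move=> i _; rewrite linearZ -scalemxAr mxtraceZ fj mulr0.
have uG : G \in unitmx.
  rewrite -row_free_unit; apply/inj_row_free => r rG0.
  rewrite -[r](vlinK (s := s)); suff -> : vlin r = 0 by rewrite linear0.
  apply/eqP; rewrite -memv0 -killing_rad0; apply/killing_radP; split.
    exact: vlin_mem.
  by apply: ext => j; rewrite -rG rG0 mxE.
pose u := vlin (l *m invmx G).
have us : u \in s := vlin_mem _.
(* The coordinates of u solve r G = l for the Gram matrix G of the Killing form, l being the
   functional y -> tr (d ad y). *)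
exists u => // x xs; pose e := d - linfun (mul u).
have eE y : e y = d y - mul u y by rewrite /e add_lfunE opp_lfunE lfunE.
have de : der_on e.
  have [d1 d2] := dd.
  split=> [y ys|y z ys zs]; rewrite !eE; first by rewrite rpredB ?d1 ?s_sub.
  by rewrite d2 // leib linearBl linearBr /= opprD addrACA.
have trE y : y \in s -> \tr (mxs s e *m adm y) = 0.
  apply: ext => j; rewrite linearB /= mulmxBl raddfB /= -rG mulmxKV //.
  by rewrite mxE subrr.
suff : e x \in killing_rad.
  by rewrite killing_rad0 memv0 eE subr_eq0 => /eqP.
apply/killing_radP; split=> [|y ys]; first exact: de.1.
rewrite adm_der // -opprB mulNmx raddfN /= mxtrace_commutator -raddfN -mulmxN opprB /=.
by rewrite -adm_mul ?trE ?s_sub.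
Qed.

End Killing.

(** * Isotypic decompositions *)

Section Modules.
Variables (F : fieldType) (L : vectType F) (mul : {bilinear L -> L -> L}).
Variable s : {vspace L}.
Implicit Types (U V W : {vspace L}).

(** The kernel and the image of f, carried into L by [vsval], are submodules of U and V. If neither
    makes f zero, f is bijective. *)
Lemma schur U V V1 V2 (f : 'Hom(subvs_of U, subvs_of V)) :
  irreducible_submodule mul s V1 U -> irreducible_submodule mul s V2 V ->
  module_hom mul s f -> ~ module_iso mul s U V -> f = 0.
Proof.
move=> [[_ Ust] _ Uirr] [[_ Vst] _ Virr] fh niso.
pose vU := linfun (vsval : subvs_of U -> L); pose vV := linfun (vsval : subvs_of V -> L).
have kerS : submodule mul s U (vU @: lker f)%VS.
  split=> [|x _ xs /memv_imgP[u uk ->]].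
    by apply/subvP => _ /memv_imgP[u _ ->]; rewrite lfunE subvsP.
  rewrite lfunE /=; have xu : mul x (vsval u) \in U by rewrite Ust ?subvsP.
  apply/memv_imgP; exists (vsproj U (mul x (vsval u))); last by rewrite lfunE /= vsprojK.
  rewrite memv_ker; apply/eqP/val_inj; rewrite /= fh //.
  by move: uk; rewrite memv_ker => /eqP->; rewrite linear0r.
have imgS : submodule mul s V (vV @: limg f)%VS.
  split=> [|x _ xs /memv_imgP[_ /memv_imgP[u _ ->] ->]].
    by apply/subvP => _ /memv_imgP[u _ ->]; rewrite lfunE subvsP.
  rewrite lfunE /= -fh //; apply/memv_imgP.
  by exists (f (vsproj U (mul x (vsval u)))); rewrite ?lfunE // memv_img ?memvf.
have f0 : (forall u, f u = 0) -> f = 0 by move=> f0; apply/lfunP => u; rewrite f0 lfunE.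
have [k0|kU] := Uirr _ kerS; last first.
  apply: f0 => u; have : vsval u \in (vU @: lker f)%VS by rewrite kU subvsP.
  move=> /memv_imgP[u' u'k]; rewrite lfunE => /val_inj->.
  by move: u'k; rewrite memv_ker => /eqP.
have [i0|iV] := Virr _ imgS.
  apply: f0 => u; apply/val_inj => /=; apply/eqP; rewrite -memv0 -i0.
  by apply/memv_imgP; exists (f u); rewrite ?lfunE // memv_img ?memvf.
case: niso; exists f; split=> //.
have fi : lker f == 0%VS.
  rewrite -subv0; apply/subvP => u uk; rewrite memv0 -(inj_eq val_inj) /= -memv0 -k0.
  by apply/memv_imgP; exists u; rewrite ?lfunE.
have fs v : v \in limg f.
  have : vsval v \in (vV @: limg f)%VS by rewrite iV subvsP.
  by move=> /memv_imgP[v' v'i]; rewrite lfunE => /val_inj->.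
by exists (f^-1)%VF; [apply: lker0_lfunK | move=> v; apply: limg_lfunVK].
Qed.

(* Coordinates on V = \sum_i \sum_(k < a i) U i k, with U i k transported to *)
(* W i.                                                                       *)
Record isotypic_maps V n (W : 'I_n -> {vspace L}) (a : 'I_n -> nat) :=
  IsotypicMaps {
    iproj : forall i, 'I_(a i) -> 'Hom(L, subvs_of (W i));
    iinj : forall i, 'I_(a i) -> 'Hom(subvs_of (W i), L);
    iinj_mem : forall i k u, @iinj i k u \in V;
    iinjK : forall i k u, @iproj i k (@iinj i k u) = u;
    iproj_neq_k : forall i k k' u, k != k' -> @iproj i k (@iinj i k' u) = 0;
    iproj_neq_i : forall i i' k k' u, i != i' -> @iproj i k (@iinj i' k' u) = 0;
    iproj_sum : forall v, v \in V -> v = \sum_i \sum_k @iinj i k (@iproj i k v);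
    iproj_hom : forall i k x v, x \in s -> v \in V ->
      @iproj i k (mul x v) = vsproj (W i) (mul x (vsval (@iproj i k v)));
    iinj_hom : forall i k x u, x \in s ->
      @iinj i k (vsproj (W i) (mul x (vsval u))) = mul x (@iinj i k u)
  }.

Lemma isotypic_mapsP V n (W : 'I_n -> {vspace L}) (a : 'I_n -> nat) :
  isotypic_decomposition mul s V W a -> inhabited (isotypic_maps V W a).
Proof.
case=> U [Usub Uiso VU Udir].
(* The double sum becomes a single one over dependent pairs, whose projections [p] are s-linear
   because every summand is a submodule. *)
pose I := {i : 'I_n & 'I_(a i)}; pose U' (x : I) := U (tag x) (tagged x).
have VU' : V = (\sum_x U' x)%VS by rewrite VU sig_big_dep.
have U'dir : directv (\sum_x U' x).
  move/directvP: Udir => /= Udim; apply/directvP => /=.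
  rewrite -VU' VU Udim sig_big_dep; exact: eq_bigr.
pose p x := sumv_pi_for VU' x.
have pU x v : p x v \in U' x by apply: memv_sum_pi.
have U'V x : (U' x <= V)%VS by rewrite VU' (sumv_sup x).
have pE (u : I -> L) : (forall x, u x \in U' x) -> forall x, p x (\sum_y u y) = u x.
  move=> uU x; have sV : \sum_y u y \in V.
    by apply: rpred_sum => y _; apply: (subvP (U'V y)).
  have := elimT directv_sum_unique U'dir _ u (fun y _ => pU y (\sum_z u z)) (fun y _ => uU y).
  by rewrite (sumv_pi_sum VU' sV) eqxx => /esym/forall_inP/(_ x isT)/eqP.
have pd x y v : v \in U' y -> p x v = if x == y then v else 0.
  move=> vU; pose u z := if z == y then v else 0.
  have -> : v = \sum_z u z.
    by rewrite (bigD1 y) //= /u eqxx big1 ?addr0 // => z /negPf->.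
  rewrite pE => [|z]; last by rewrite /u; case: eqP => [->|_]; rewrite ?mem0v.
  by rewrite /u (bigD1 y) //= eqxx big1 ?addr0 // => z /negPf->.
have pm x y v : y \in s -> v \in V -> p x (mul y v) = mul y (p x v).
  move=> ys vV; rewrite -{1}(sumv_pi_sum VU' vV) linear_sum /=.
  rewrite (pE (fun z => mul y (p z v))) // => z.
  by have [_] := Usub (tag z) (tagged z); apply=> //; apply: pU.
have fP i k := cid (Uiso i k); pose f i k := sval (fP i k).
have fh i k : module_hom mul s (f i k) by have [] := svalP (fP i k).
have fK i k : cancel (f i k) (f i k)^-1%VF.
  apply: lker0_lfunK; apply/lker0P; apply: bij_inj.
  by have [] := svalP (fP i k).
have Kf i k : cancel (f i k)^-1%VF (f i k).
  move=> w; apply: limg_lfunVK; have [_ [g gK Kg]] := svalP (fP i k).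
  by rewrite -[w]Kg memv_img ?memvf.
pose E i (k : 'I_(a i)) : 'Hom(L, subvs_of (W i)) :=
  (f i k \o linfun (vsproj (U i k)) \o p (Tagged _ k))%VF.
pose E' i (k : 'I_(a i)) : 'Hom(subvs_of (W i), L) :=
  (linfun (vsval : subvs_of (U i k) -> L) \o (f i k)^-1)%VF.
have EE i k v : E i k v = f i k (vsproj (U i k) (p (Tagged _ k) v)).
  by rewrite !comp_lfunE lfunE.
have E'E i k u : E' i k u = vsval ((f i k)^-1%VF u).
  by rewrite !comp_lfunE lfunE.
have E'U i k u : E' i k u \in U' (Tagged _ k) by rewrite E'E subvsP.
constructor; apply: (@IsotypicMaps _ _ _ _ E E').
- by move=> i k u; apply: (subvP (U'V (Tagged _ k))).
- move=> i k u; rewrite EE (pd _ _ _ (E'U i k u)) eqxx.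
  by rewrite E'E vsvalK Kf.
- move=> i k k' u kk; rewrite EE (pd _ _ _ (E'U i k' u)) eq_Tagged /= (negPf kk).
  by rewrite !linear0.
- move=> i i' k k' u ii; rewrite EE (pd _ _ _ (E'U i' k' u)).
  case: eqP => [/(congr1 tag) /= e|_]; first by rewrite e eqxx in ii.
  by rewrite !linear0.
- move=> v vV; rewrite sig_big_dep /= -{1}(sumv_pi_sum VU' vV).
  apply: eq_bigr => -[i k] _ /=; rewrite E'E EE fK vsprojK //.
- move=> i k x v xs vV; rewrite !EE pm //; apply/val_inj => /=.
  set u := vsproj _ (p _ v).
  have -> : p (Tagged _ k) v = vsval u by rewrite vsprojK //; apply: (pU (Tagged _ k)).
  by rewrite fh // vsprojK // -fh // subvsP.
- move=> i k x u xs; rewrite !E'E -{1}[u](Kf i k) -fh // vsvalK fK vsprojK //.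
  by have [_ Ust] := Usub i k; rewrite Ust ?subvsP.
Qed.

End Modules.

(** * Homomorphisms between isotypic sums, block by block *)

Section HomDecomposition.
Variables (F : fieldType) (L : vectType F) (mul : {bilinear L -> L -> L}).
Variables (s A B : {vspace L}).
Variables (p : nat) (W : 'I_p -> {vspace L}) (a : 'I_p -> nat).
Variables (q : nat) (M : 'I_q -> {vspace L}) (b : 'I_q -> nat).
Variables (EA : isotypic_maps mul s A W a) (EB : isotypic_maps mul s B M b).
Variables (C : finType) (ci : C -> 'I_p) (cj : C -> 'I_q) (N : C -> nat).
Variable idx : forall c, 'I_(N c) -> 'I_(a (ci c)) * 'I_(b (cj c)).
Hypothesis Mst : forall j x w, x \in s -> w \in M j -> mul x w \in M j.
Hypothesis idx_bij : forall c, bijective (@idx c).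
Hypothesis cij_inj : forall c c', ci c = ci c' -> cj c = cj c' -> c = c'.
Hypothesis C_cover : forall i j, (exists2 c, ci c = i & cj c = j) \/
  forall f : 'Hom(subvs_of (W i), subvs_of (M j)), module_hom mul s f -> f = 0.

(** C indexes the blocks that may be nonzero, and [idx] enumerates the matrix positions in a block.
    Taking C to be all pairs (i, j) covers s -> K; taking only the diagonal covers K -> K, where
    [C_cover] comes from Schur's lemma. *)
Definition hom_fam := dsum (fun c =>
  {ffun 'I_(N c) -> subvs_of (Hom_mod mul s (W (ci c)) (M (cj c)))}).

Definition hom_glue (t : hom_fam) : 'End(L) :=
  \sum_c \sum_m
    (iinj EB (idx m).2 \o vsval (t c m) \o iproj EA (idx m).1)%VF.

Lemma hom_glueE t v : hom_glue t v =
  \sum_c \sum_m iinj EB (idx m).2 (vsval (t c m) (iproj EA (idx m).1 v)).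
Proof.
rewrite sum_lfunE; apply: eq_bigr => c _; rewrite sum_lfunE.
by apply: eq_bigr => m _; rewrite !comp_lfunE.
Qed.

Fact hom_glue_is_linear : linear hom_glue.
Proof.
move=> k t u; apply/lfunP => v; rewrite add_lfunE scale_lfunE !hom_glueE.
rewrite scaler_sumr -big_split; apply: eq_bigr => c _.
rewrite scaler_sumr -big_split; apply: eq_bigr => m _ /=.
by rewrite !ffunE linearP add_lfunE scale_lfunE linearP.
Qed.
HB.instance Definition _ :=
  GRing.isLinear.Build F _ _ _ hom_glue hom_glue_is_linear.

Lemma hom_glue_mem t v : hom_glue t v \in B.
Proof.
rewrite hom_glueE; apply: rpred_sum => c _; apply: rpred_sum => m _.
exact: iinj_mem.
Qed.

Lemma hom_glue_hom t x v : x \in s -> v \in A ->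
  hom_glue t (mul x v) = mul x (hom_glue t v).
Proof.
move=> xs vA; rewrite !hom_glueE linear_sum; apply: eq_bigr => c _ /=.
rewrite linear_sum; apply: eq_bigr => m _ /=.
have /Hom_modP th := subvsP (t c m).
rewrite iproj_hom // -(iinj_hom EB _ _ xs); congr (iinj _ _ _).
by rewrite -th // vsvalK.
Qed.

Lemma hom_glue_coef t c (m : 'I_(N c)) u :
  iproj EB (idx m).2 (hom_glue t (iinj EA (idx m).1 u)) = vsval (t c m) u.
Proof.
rewrite hom_glueE (bigD1 c) //= (bigD1 m) //= !linearD /= !iinjK.
rewrite !linear_sum !big1 ?addr0 //= => [c' cc|m' mm].
  rewrite linear_sum big1 // => m' _ /=.
  have [e|ne] := eqVneq (cj c) (cj c'); last by rewrite (iproj_neq_i EB).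
  rewrite (iproj_neq_i EA) ?linear0 //.
  by apply: contraNneq cc => e'; apply/eqP/cij_inj.
have [e|ne] := eqVneq (idx m).2 (idx m').2; last by rewrite (iproj_neq_k EB).
rewrite (iproj_neq_k EA) ?linear0 //.
apply: contraNneq mm => e'; apply/eqP/(bij_inj (idx_bij c)).
by rewrite [LHS]surjective_pairing -e e' -surjective_pairing.
Qed.

Lemma hom_glue_inj t : (forall v, v \in A -> hom_glue t v = 0) -> t = 0.
Proof.
move=> t0; apply/ffunP => c; rewrite ffunE; apply/ffunP => m; rewrite ffunE.
apply/val_inj => /=; apply/lfunP => u.
by rewrite -hom_glue_coef t0 ?iinj_mem // linear0 lfunE.
Qed.

Lemma hom_coef_hom (f : 'End(L)) i j (k : 'I_(a i)) (l : 'I_(b j)) :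
  (forall v, v \in A -> f v \in B) ->
  (forall x v, x \in s -> v \in A -> f (mul x v) = mul x (f v)) ->
  module_hom mul s (iproj EB l \o f \o iinj EA k)%VF.
Proof.
move=> fB fh x u xs; rewrite !comp_lfunE /= iinj_hom // fh ?iinj_mem //.
by rewrite iproj_hom ?fB ?iinj_mem // vsprojK // Mst ?subvsP.
Qed.

(** The entries of t are the coefficients of f. In a block not indexed by C the coefficients of f
    and of the glued map are both homomorphisms, hence both zero. *)
Lemma hom_glue_surj (f : 'End(L)) :
  (forall v, v \in A -> f v \in B) ->
  (forall x v, x \in s -> v \in A -> f (mul x v) = mul x (f v)) ->
  exists t, forall v, v \in A -> hom_glue t v = f v.
Proof.
move=> fB fh.
pose t : hom_fam := [ffun c => [ffun m : 'I_(N c) =>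
  vsproj (Hom_mod mul s (W (ci c)) (M (cj c)))
    (iproj EB (idx m).2 \o f \o iinj EA (idx m).1)%VF]].
exists t => v vA; rewrite (iproj_sum EA vA) !linear_sum; apply: eq_bigr => i _ /=.
rewrite !linear_sum; apply: eq_bigr => k _ /=; move: (iproj EA k v) => u.
rewrite [LHS](iproj_sum EB (hom_glue_mem _ _)).
rewrite [RHS](iproj_sum EB (fB _ (iinj_mem EA _ _))).
apply: eq_bigr => j _; apply: eq_bigr => l _; congr (iinj EB _ _).
have th x w : x \in s -> w \in A -> hom_glue t (mul x w) = mul x (hom_glue t w).
  exact: hom_glue_hom.
have [[c ei ej]|z] := C_cover i j; last first.
  have Et := z _ (hom_coef_hom k l (fun v _ => hom_glue_mem t v) th).
  have Ef := z _ (hom_coef_hom k l fB fh).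
  have /lfunP/(_ u) := Et; have /lfunP/(_ u) := Ef.
  by rewrite !comp_lfunE => -> ->.
subst i j; have [g _ gK] := idx_bij c.
have [m Em] : exists m, idx m = (k, l) by exists (g (k, l)).
have -> : k = (idx m).1 by rewrite Em.
have -> : l = (idx m).2 by rewrite Em.
rewrite hom_glue_coef !ffunE vsprojK ?comp_lfunE //.
by apply/Hom_modP/hom_coef_hom.
Qed.

End HomDecomposition.

(** * Derivations of a semi-simple Leibniz algebra *)

Lemma ord_bij (T : finType) n : #|T| = n -> exists f : 'I_n -> T, bijective f.
Proof.
move=> Tn; exists (fun m => enum_val (cast_ord (esym Tn) m)).
exists (fun x => cast_ord Tn (enum_rank x)) => x.
  by rewrite enum_valK cast_ordKV.
by rewrite cast_ordK enum_rankK.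
Qed.

Lemma linear_bij_inv (F : fieldType) (U V : lmodType F) (f : {linear U -> V}) :
  injective f -> (forall v, exists u, f u = v) ->
  exists g : {linear V -> U}, bijective g.
Proof.
move=> fI fS; pose g v := sval (cid (fS v)).
have gK v : f (g v) = v by apply: svalP (cid (fS v)).
have fK u : g (f u) = u by apply: fI; rewrite gK.
have glin : linear g by move=> c u v; apply: fI; rewrite linearP !gK.
pose gL := GRing.isLinear.Build F V U _ g glin.
pose G : {linear V -> U} := HB.pack g gL.
by exists G; exists f.
Qed.

(** * The Leibniz kernel and derivations *)

Section Leibniz.
Variables (F : fieldType) (L : vectType F) (mul : {bilinear L -> L -> L}).
Hypothesis leib : left_leibniz mul.
Local Notation K := (Leib mul fullv).

(** The identity x(xz) = (xx)z + x(xz) gives (xx)z = 0. *)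
Lemma Leib_mul0 k y : k \in K -> mul k y = 0.
Proof.
pose P k := forall y, mul k y = 0; move=> kK.
have: k \in lspan P.
  apply: subvP kK; apply: lspan_sub => _ [x _ ->]; apply: mem_lspan => z.
  by apply/eqP; have /eqP := leib x x z; rewrite -subr_eq subrr eq_sym.
move/lspan_closed; apply => [z|c u v u0 v0 z]; first exact: linear0l.
by rewrite linearPl u0 v0 scaler0 addr0.
Qed.

Lemma Leib_sqr x : mul x x \in K.
Proof. by apply: mem_lspan; exists x; rewrite ?memvf. Qed.

(** D(xx) = D(x)x + xD(x) is, by polarization, a combination of squares. *)
Lemma Leib_derivation (D : 'End(L)) k : derivation mul D -> k \in K -> D k \in K.
Proof.
move=> DD kK; suff : (K <= D @^-1: K)%VS by move/subvP/(_ k kK); rewrite -memv_preim.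
apply: lspan_sub => _ [x _ ->]; rewrite -memv_preim DD.
have -> : mul (D x) x + mul x (D x) =
    mul (x + D x) (x + D x) - mul x x - mul (D x) (D x).
  by rewrite linearDl !linearDr /= -(addrA (mul x x)) (addrC (mul x x)) addrK addrA addrK addrC.
by rewrite !rpredB ?Leib_sqr.
Qed.

Lemma derivation_left_mul u : derivation mul (linfun (mul u)).
Proof. by move=> x y; rewrite !lfunE /= leib. Qed.

Lemma Leib_left x k : k \in K -> mul x k \in K.
Proof. by move/(Leib_derivation (derivation_left_mul x)); rewrite lfunE. Qed.

End Leibniz.

(** * Parametrization of the derivations *)

Section Main.
Variables (F : fieldType) (L : vectType F).
Variables (mul : {bilinear L -> L -> L}) (s : {vspace L}).
Variables (p : nat) (S : 'I_p -> {vspace L}) (a : 'I_p -> nat).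
Variables (q : nat) (M : 'I_q -> {vspace L}) (b : 'I_q -> nat).
Hypotheses (F0 : [pchar F] =i pred0) (leib : left_leibniz mul).
Hypothesis levi : levi_factor mul s.
Hypothesis decS : isotypic_decomposition mul s s S a.
Hypothesis irrM : forall j, irreducible_submodule mul s (Leib mul fullv) (M j).
Hypothesis nisoM : forall j j', j != j' -> ~ module_iso mul s (M j) (M j').
Hypothesis decM : isotypic_decomposition mul s (Leib mul fullv) M b.
Local Notation K := (Leib mul fullv).

Local Notation T1 := (dsum (fun ij : 'I_p * 'I_q =>
  {ffun 'I_(a ij.1 * b ij.2) -> subvs_of (Hom_mod mul s (S ij.1) (M ij.2))})).
Local Notation T2 := (dsum (fun k : 'I_q =>
  {ffun 'I_(b k ^ 2) -> subvs_of (End_mod mul s (M k))})).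

Let s_sub : subalgebra mul s. Proof. by case: levi => -[]. Qed.
Let s_alt x : x \in s -> mul x x = 0. Proof. by case: levi => -[_ +] _ _ _; apply. Qed.
Let s_ss I : ideal mul s I -> solvable mul I -> I = 0%VS.
Proof.
case: levi => _ ss _ _ idI sol; apply/eqP; rewrite -subv0.
apply: subv_trans (ss _ idI sol) _; apply: lspan_sub => _ [x xs ->].
by rewrite s_alt ?mem0v.
Qed.
Let sK0 : (s :&: K = 0)%VS. Proof. by case: levi => _ _ _ /directv_addP. Qed.
Let sKT v : v \in (s + K)%VS. Proof. by have [_ _ E _] := levi; rewrite E memvf. Qed.

Let pi : 'End(L) := daddv_pi s K.
Let rho : 'End(L) := daddv_pi K s.

Let pis v : pi v \in s. Proof. exact: memv_pi. Qed.
Let rhoK v : rho v \in K. Proof. exact: memv_pi. Qed.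
Let pi_id v : v \in s -> pi v = v. Proof. exact: daddv_pi_id. Qed.
Let rho_id v : v \in K -> rho v = v.
Proof. by apply: daddv_pi_id; rewrite capvC. Qed.
Let pi_rho v : pi v + rho v = v. Proof. by apply: daddv_pi_add. Qed.
Let pi0 v : v \in K -> pi v = 0.
Proof. by move=> vK; apply: (addIr v); rewrite add0r -{2}[v]rho_id // pi_rho. Qed.
Let rho0 v : v \in s -> rho v = 0.
Proof. by move=> vs; apply: (addrI v); rewrite addr0 -{1}[v]pi_id // pi_rho. Qed.
Let pi_mul x v : x \in s -> pi (mul x v) = mul x (pi v).
Proof.
move=> xs; rewrite -{1}[v]pi_rho linearDr linearD /= pi_id ?s_sub //.
by rewrite [pi (mul x (rho v))]pi0 ?addr0 // (Leib_left leib).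
Qed.
Let rho_mul x v : x \in s -> rho (mul x v) = mul x (rho v).
Proof.
move=> xs; rewrite -{1}[v]pi_rho linearDr linearD /= rho0 ?s_sub //.
by rewrite [rho (mul x (rho v))]rho_id ?add0r // (Leib_left leib).
Qed.

(** Since f x lies in K, (f x) y = 0, and the Leibniz rule reduces to f (x y) = x (f y). There x may
    be replaced by its s-component. *)
Lemma derivation_to_Leib (f : 'End(L)) :
  (forall v, f v \in K) -> (forall x v, x \in s -> f (mul x v) = mul x (f v)) ->
  derivation mul f.
Proof.
move=> fK fh x y; rewrite (Leib_mul0 leib _ (fK x)) add0r -[x]pi_rho !linearDl /=.
by rewrite !(Leib_mul0 leib _ (rhoK x)) !addr0 fh.
Qed.

Lemma derivation_parametrization : exists psi : {linear (subvs_of s * T1 * T2)%type -> subvs_of (Der mul)},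
  injective psi /\ forall D, exists t, psi t = D.
Proof.
have [ES] := isotypic_mapsP decS; have [EM] := isotypic_mapsP decM.
have Mst j x w : x \in s -> w \in M j -> mul x w \in M j.
  by case: (irrM j) => -[_ st] _ _; apply: st.
have cardI m n : #|{: 'I_m * 'I_n}| = (m * n)%N by rewrite card_prod !card_ord.
pose idx1 (c : 'I_p * 'I_q) := sval (cid (ord_bij (cardI (a c.1) (b c.2)))).
have idx1_bij c : bijective (idx1 c) by apply: (svalP (cid (ord_bij _))).
pose idx2 (k : 'I_q) : 'I_(b k ^ 2) -> _ := sval (cid (ord_bij (cardI (b k) (b k)))).
have idx2_bij c : bijective (idx2 c) by apply: (svalP (cid (ord_bij _))).
have cover1 i j : (exists2 c : 'I_p * 'I_q, c.1 = i & c.2 = j) \/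
    forall f : 'Hom(subvs_of (S i), subvs_of (M j)), module_hom mul s f -> f = 0.
  by left; exists (i, j).
have cover2 i j : (exists2 c : 'I_q, c = i & c = j) \/
    forall f : 'Hom(subvs_of (M i), subvs_of (M j)), module_hom mul s f -> f = 0.
  have [->|ij] := eqVneq i j; first by left; exists j.
  by right=> f fh; apply: schur (irrM i) (irrM j) fh (nisoM ij).
have inj1 (c c' : 'I_p * 'I_q) : c.1 = c'.1 -> c.2 = c'.2 -> c = c'.
  by case: c c' => [i j] [i' j'] /= -> ->.
have inj2 (c c' : 'I_q) : c = c' -> c = c' -> c = c' by [].
pose g1 : T1 -> 'End(L) := hom_glue ES EM idx1.
pose g2 : T2 -> 'End(L) := hom_glue EM EM idx2.
have [psi0 psi0D] : exists psi0 : (subvs_of s * T1 * T2)%type -> 'End(L),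
    forall t, psi0 t = linfun (mul (vsval t.1.1)) +
      ((g1 t.1.2 \o pi)%VF + (g2 t.2 \o rho)%VF) by eexists.
have psi0E t v : psi0 t v = mul (vsval t.1.1) v + (g1 t.1.2 (pi v) + g2 t.2 (rho v)).
  by rewrite psi0D !add_lfunE !comp_lfunE lfunE.
have psi0_Der t : psi0 t \in Der mul.
  rewrite psi0D rpredD //; apply/DerP; first exact: derivation_left_mul.
  apply: derivation_to_Leib => [v|x v xs]; rewrite !add_lfunE !comp_lfunE.
    by rewrite rpredD // hom_glue_mem.
  by rewrite pi_mul // rho_mul // /g1 /g2 !hom_glue_hom // linearDr.
have psi0_lin : linear psi0.
  move=> c t t'; apply/lfunP => v; rewrite add_lfunE scale_lfunE !psi0E.
  have -> : vsval (c *: t + t').1.1 = c *: vsval t.1.1 + vsval t'.1.1.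
    exact: (linearP (vsval : subvs_of s -> L)).
  have -> : g1 (c *: t + t').1.2 = c *: g1 t.1.2 + g1 t'.1.2.
    exact: (linearP (hom_glue ES EM idx1)).
  have -> : g2 (c *: t + t').2 = c *: g2 t.2 + g2 t'.2.
    exact: (linearP (hom_glue EM EM idx2)).
  rewrite !add_lfunE !scale_lfunE linearPl !scalerDr /=.
  by rewrite [RHS]addrACA [X in _ = _ + X]addrACA.
pose psi1 t := vsproj (Der mul) (psi0 t).
have psi1_lin : linear psi1 by move=> c t t'; rewrite /psi1 psi0_lin linearP.
pose psiL := GRing.isLinear.Build F _ (subvs_of (Der mul)) _ psi1 psi1_lin.
pose psi : {linear (subvs_of s * T1 * T2)%type -> subvs_of (Der mul)} :=
  HB.pack psi1 psiL.
have psiE t : vsval (psi t) = psi0 t by apply: vsprojK; apply: psi0_Der.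
exists psi; split.
  suff psi_ker t : psi t = 0 -> t = 0.
    by move=> t t' tt; apply/eqP; rewrite -subr_eq0; apply/eqP/psi_ker; rewrite linearB tt subrr.
  move=> t0; have tv v : psi0 t v = 0 by rewrite -psiE t0 lfunE.
  (* On s the first term takes values in s and the second in K, so both vanish separately. *)
  have ts v : v \in s -> mul (vsval t.1.1) v = 0 /\ g1 t.1.2 v = 0.
    move=> vs; have := tv v; rewrite psi0E pi_id // rho0 // linear0 addr0 => E.
    have mu0 : mul (vsval t.1.1) v = 0.
      by rewrite -[LHS]pi_id ?s_sub ?subvsP // -[RHS](pi0 (mem0v _)) -E linearD /= [pi (g1 _ _)]pi0 ?addr0 ?hom_glue_mem.
    by move: E; rewrite mu0 add0r.
  (* An element acting as zero on s lies in the radical of the Killing form. *)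
  have u0 : t.1.1 = 0.
    apply/val_inj/eqP; rewrite /= -memv0 -(killing_rad0 F0 leib s_sub s_alt s_ss).
    apply/killing_radP; split=> [|y ys]; first exact: subvsP.
    rewrite /adm (_ : mxs s _ = 0) ?mul0mx ?mxtrace0 //.
    rewrite -[RHS](linear0 (mxs s)); apply: eq_mxs => v /ts[u0 _].
    by rewrite !lfunE /= u0.
  have t1 : t.1.2 = 0.
    by apply: (hom_glue_inj (EA := ES) (EB := EM) (idx := idx1) idx1_bij inj1) => v /ts[_].
  have t2 : t.2 = 0.
    apply: (hom_glue_inj (EA := EM) (EB := EM) (idx := idx2) idx2_bij inj2) => v vK.
    have := tv v; rewrite psi0E u0 linear0l add0r pi0 // linear0 add0r.
    by rewrite rho_id.
  by rewrite [t]surjective_pairing [t.1]surjective_pairing u0 t1 t2.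
move=> D; have DD : derivation mul (vsval D) by apply/DerP/subvsP.
(* The s-component of D is a derivation of s because the K-component of D x multiplies by zero on
   the left. *)
have [|u us uP] := @derivation_inner F L mul s F0 leib s_sub s_alt s_ss (pi \o vsval D)%VF.
  split=> [x xs|x y xs ys]; rewrite !comp_lfunE ?pis // DD linearD /=.
  rewrite (pi_mul _ xs) -{1}[vsval D x]pi_rho linearDl /=.
  by rewrite (Leib_mul0 leib _ (rhoK _)) addr0 pi_id // s_sub.
pose f := vsval D - linfun (mul u).
have fE v : f v = vsval D v - mul u v by rewrite add_lfunE opp_lfunE lfunE.
have fD : derivation mul f.
  by apply/DerP; rewrite rpredB //; apply/DerP => //; apply: derivation_left_mul.
have fs v : v \in s -> f v \in K.
  move=> vs; rewrite fE -uP // comp_lfunE -{1}[vsval D v]pi_rho addrC addKr.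
  exact: rhoK.
have fK v : v \in K -> f v \in K by apply: Leib_derivation.
(* The term (f x) v of the Leibniz rule vanishes because f x lies in K. *)
have fh x v : x \in s -> f (mul x v) = mul x (f v).
  by move=> xs; rewrite fD (Leib_mul0 leib) ?add0r ?fs.
have [t1 t1P] := hom_glue_surj ES EM (idx := idx1) Mst idx1_bij inj1 cover1 fs (fun x v xs _ => fh x v xs).
have [t2 t2P] := hom_glue_surj EM EM (idx := idx2) Mst idx2_bij inj2 cover2 fK (fun x v xs _ => fh x v xs).
exists (Subvs us, t1, t2); apply/val_inj/lfunP => v; rewrite /= psiE psi0E /=.
by rewrite /g1 /g2 t1P // t2P // -linearD /= pi_rho fE addrC subrK.
Qed.

End Main.

Theorem theorem4p4 (F : fieldType) (L : vectType F)
    (mul : {bilinear L -> L -> L}) (s : {vspace L})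
    (p : nat) (S : 'I_p -> {vspace L}) (a : 'I_p -> nat)
    (q : nat) (M : 'I_q -> {vspace L}) (b : 'I_q -> nat) :
  [pchar F] =i pred0 ->
  left_leibniz mul ->
  semisimple mul fullv ->
  levi_factor mul s ->
  (forall i, simple_ideal mul s (S i)) ->
  (forall i i', i != i' -> ~ module_iso mul s (S i) (S i')) ->
  isotypic_decomposition mul s s S a ->
  (forall j, irreducible_submodule mul s (Leib mul fullv) (M j)) ->
  (forall j, ~ trivial_module mul s (M j)) ->
  (forall j j', j != j' -> ~ module_iso mul s (M j) (M j')) ->
  isotypic_decomposition mul s (Leib mul fullv) M b ->
  exists phi : {linear subvs_of (Der mul) ->
      (subvs_of s
       * dsum (fun ij : 'I_p * 'I_q =>
           {ffun 'I_(a ij.1 * b ij.2) ->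
              subvs_of (Hom_mod mul s (S ij.1) (M ij.2))})
       * dsum (fun k : 'I_q =>
           {ffun 'I_(b k ^ 2) -> subvs_of (End_mod mul s (M k))}))%type},
    bijective phi.
Proof.
move=> F0 leib _ levi _ _ decS irrM _ nisoM decM.
have [psi [psi_inj psi_surj]] :=
  derivation_parametrization F0 leib levi decS irrM nisoM decM.
exact: linear_bij_inv psi_inj psi_surj.
Qed.
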